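(* Let $(M^n,g)$ be an $n$-dimensional asymptotically Euclidean (AE) manifold, $n\geq3$, such that: (i) there is a structure at infinity in whose coordinates $g_{ij}=\delta_{ij}+O_4(r^{-\tau})$ with $\tau>\tau_n$, where $\tau_n=0$ if $n=3,4$ and $\tau_n=\frac n2-2$ if $n\ge5$; (ii) $Q_g\in L^1(M,dV_g)$. If $R_g>0$ on $M\setminus K$ for some compact set $K\subset M$, then the fourth order energy satisfies $\mathcal{E}(g)\geq0$.
   Context: Manifolds are smooth. A complete Riemannian manifold $(M^n,g)$ is AE (with one end) if there are a compact set $K_0\subset M$ and a diffeomorphism $\Phi:M\setminus K_0\to\mathbb{R}^n\setminus\overline{B_1(0)}$ (a structure at infinity), with associated coordinates $x$ and $r=|x|$, such that $\lambda^{-1}|\xi|^2\le g_{ij}\xi^i\xi^j\le\lambda|\xi|^2$ for some $\lambda>1$, and $g_{ij}-\delta_{ij}=O_4(r^{-\tau})$ for some $\tau>0$. Here $f=O_k(r^{a})$ means $\partial^\beta f=O(r^{a-|\beta|})$ as $r\to\infty$ for all $|\beta|\le k$. With $\Delta_g=g^{ij}\nabla_i\nabla_j$ and $R_g$ the scalar curvature, the $Q$-curvature is $$Q_g=-\frac{1}{2(n-1)}\Delta_gR_g-\frac{2}{(n-2)^2}|\mathrm{Ric}_g|_g^2+\frac{n^3-4n^2+16n-16}{8(n-1)^2(n-2)^2}R_g^2 .$$ The fourth order energy is $$\mathcal{E}(g)=\lim_{r\to\infty}\int_{S_r^{n-1}}\left(\partial_j\partial_i\partial_i g_{aa}-\partial_j\partial_u\partial_i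 g_{ui}\right)\nu^j\,d\omega_r,$$ computed in a structure at infinity satisfying (i), with repeated indices summed, $S_r^{n-1}=\{|x|=r\}$, $\nu$ its Euclidean outward unit normal and $d\omega_r$ its Euclidean volume element. Under (i) and (ii) this limit exists and does not depend on the structure at infinity satisfying (i). *)

(* Defs.v *)
From HB Require Import structures.
From mathcomp Require Import all_boot all_order all_algebra.
From mathcomp Require Import all_classical all_reals all_analysis measurable_realfun.

Set Implicit Arguments.
Unset Strict Implicit.
Unset Printing Implicit Defensive.

Import Order.TTheory GRing.Theory Num.Theory.
Import numFieldNormedType.Exports.

Local Open Scope classical_set_scope.
Local Open Scope ring_scope.

Notation borel T := (g_sigma_algebraType (@open T)).

Section lebesgue_rV.
Variable R : realType.

Lemma measurable_coord n (i : 'I_n) :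
  measurable_fun setT (fun v : borel 'rV[R]_n => v 0 i : R).
Proof.
apply: (measurability _ (RGenOInfty.measurableE R)).
move=> _ [_ [x ->] <-]; rewrite setTI; apply: sub_sigma_algebra.
apply: (@open_comp _ _ (fun v : 'rV[R]_n => v 0 i) _).
  by move=> v _; exact: coord_continuous.
exact: interval_open.
Qed.

Lemma measurable_fun_rV d (T : measurableType d) n (f : T -> 'rV[R]_n) :
  (forall i, measurable_fun setT (fun t => f t 0 i)) ->
  measurable_fun setT (f : T -> borel 'rV[R]_n).
Proof.
move=> mf; apply: (@measurability _ _ _ (borel 'rV[R]_n) _ f (@open 'rV[R]_n)) => //.
move=> _ [U oU <-]; rewrite setTI.
pose I := (nat * 'rV[rat]_n)%type.
pose box (q : I) : set 'rV[R]_n :=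
  [set v | forall i, `|ratr (q.2 0 i) - v 0 i| < q.1.+1%:R^-1].
have -> : f @^-1` U = \bigcup_(q in [set q | box q `<=` U]) (f @^-1` box q).
  apply/seteqP; split=> t; last by move=> [q qU] /qU.
  move=> /= Uft; have /nbhs_ballP[e /= e0 eU] : nbhs (f t) U by exact: open_nbhs_nbhs.
  have e20 : 0 < e / 2 by rewrite divr_gt0.
  have [k _ /(_ k (leqnn k)) /= ke] := near_infty_natSinv_lt (PosNum e20).
  have k0 : 0 < k.+1%:R^-1 :> R by rewrite invr_gt0.
  have hq i : exists q : rat, `|ratr q - f t 0 i| < k.+1%:R^-1.
    have [|q] := @rat_in_itvoo R (f t 0 i - k.+1%:R^-1) (f t 0 i + k.+1%:R^-1).
      by rewrite ltrD2l; rewrite (lt_trans _ k0)// oppr_lt0.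
    rewrite in_itv/= => /andP[q1 q2]; exists q.
    by rewrite ltr_norml ltrBrDl q1 ltrBlDl q2.
  have [q hqq] := choice hq.
  exists (k, \row_i q i) => /=; last by move=> i; rewrite mxE.
  move=> v /= hv; apply: eU; split=> // a i; rewrite ord1 /ball/=.
  have := hv i; rewrite mxE => hvi.
  rewrite -(subrKA (ratr (q i))) (le_lt_trans (ler_normD _ _))//.
  by rewrite [e]splitr ltrD// ?(lt_trans _ ke)// distrC.
rewrite bigcup_mkcond; apply: countable_bigcupT_measurable.
  exact: countableP.
move=> q; case: ifP => // _.
have -> : f @^-1` box q = ~` \bigcup_(i : 'I_n)
    ~` ((fun t => f t 0 i) @^-1` ball (ratr (q.2 0 i) : R) q.1.+1%:R^-1).
  rewrite setC_bigcup; apply/seteqP; split=> t /= ht i; first by move=> _ /(_ (ht i)).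
  by apply: contrapT; exact: (ht i Logic.I).
apply: measurableC; apply: countable_bigcupT_measurable; first exact: countableP.
move=> i; apply: measurableC; rewrite -[X in measurable X]setTI.
by apply: mf => //; exact: measurable_ball.
Qed.

Definition cons_rV n (z : R * borel 'rV[R]_n) : borel 'rV[R]_n.+1 :=
  row_mx (const_mx z.1 : 'rV_1) (z.2 : 'rV_n).

Definition head_rV n (v : borel 'rV[R]_n.+1) : R * borel 'rV[R]_n :=
  (v 0 0 : R, rsubmx (v : 'rV_(1 + n))).

Lemma measurable_cons_rV n : measurable_fun setT (@cons_rV n).
Proof.
apply: measurable_fun_rV => i.
case: (split_ordP (i : 'I_(1 + n))) => j ->.
  rewrite (_ : (fun t => _) = fst); first exact: measurable_fst.
  apply/funext => t; rewrite /cons_rV.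
  by rewrite [LHS](@row_mxEl R 1 1 n (const_mx t.1) t.2) mxE.
rewrite (_ : (fun t => _) = (fun v : borel 'rV[R]_n => v 0 j : R) \o snd).
  by apply: measurableT_comp; [exact: measurable_coord|exact: measurable_snd].
apply/funext => t; rewrite /cons_rV.
by rewrite [LHS](@row_mxEr R 1 1 n (const_mx t.1) t.2).
Qed.

Lemma measurable_head_rV n : measurable_fun setT (@head_rV n).
Proof.
apply/measurable_fun_pairP; split; first exact: measurable_coord.
apply: measurable_fun_rV => i /=.
under eq_fun do rewrite mxE; exact: measurable_coord.
Qed.

Section cons_measure.
Variables (n : nat) (mu : {sigma_finite_measure set (borel 'rV[R]_n) -> \bar R}).

Definition cons_measure :=
  pushforward (@lebesgue_measure R \x mu)%E (@cons_rV n).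

Let mcons A : measurable A -> measurable (@cons_rV n @^-1` A).
Proof.
by move=> mA; rewrite -[X in measurable X]setTI; exact: measurable_cons_rV.
Qed.

Let cons_measure0 : cons_measure set0 = 0%E.
Proof. by rewrite /cons_measure /pushforward preimage_set0 measure0. Qed.

Let cons_measure_ge0 A : (0 <= cons_measure A)%E.
Proof. by rewrite /cons_measure /pushforward; exact: measure_ge0. Qed.

Let cons_measure_sigma_additive : semi_sigma_additive cons_measure.
Proof.
move=> F mF tF mUF; rewrite /cons_measure /pushforward preimage_bigcup.
apply: measure_semi_sigma_additive.
- by move=> k; exact: mcons.
- apply/trivIsetP => /= i j _ _ ij; rewrite -preimage_setI.
  by move/trivIsetP : tF => /(_ _ _ _ _ ij) ->//; rewrite preimage_set0.
- by rewrite -preimage_bigcup; exact: mcons.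
Qed.

HB.instance Definition _ := isMeasure.Build _ _ _ cons_measure
  cons_measure0 cons_measure_ge0 cons_measure_sigma_additive.

Let cons_measure_sigma_finite : sigma_finite setT cons_measure.
Proof.
have /sigma_finiteP[F [TF ndF Foo]] := sigma_finiteT (@lebesgue_measure R).
have /sigma_finiteP[G [TG ndG Goo]] := sigma_finiteT mu.
exists (fun k => @head_rV n @^-1` (F k `*` G k)).
  apply/seteqP; split=> // v _.
  have [k _ Fk] : (\bigcup_k F k) (v 0 0) by rewrite -TF.
  have [l _ Gl] : (\bigcup_k G k) (@head_rV n v).2 by rewrite -TG.
  exists (maxn k l) => //; split.
  - by move: Fk; exact/subsetPset/ndF/leq_maxl.
  - by move: Gl; exact/subsetPset/ndG/leq_maxr.
move=> k; have [mF Fk] := Foo k; have [mG Gk] := Goo k; split.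
  rewrite -[X in measurable X]setTI; apply: measurable_head_rV => //.
  exact: measurableX.
have cK : @head_rV n \o @cons_rV n = id.
  apply/funext => -[t v] /=; rewrite /head_rV /cons_rV.
  rewrite (@row_mxKr R 1 1 n); congr pair.
  have -> : 0 = lshift n 0 :> 'I_(1 + n) by exact/val_inj.
  by rewrite (@row_mxEl R 1 1 n) mxE.
rewrite /cons_measure /pushforward -comp_preimage cK preimage_id.
by rewrite product_measure1E// lte_mul_pinfty// ge0_fin_numE.
Qed.

HB.instance Definition _ := Measure_isSigmaFinite.Build _ _ _ cons_measure
  cons_measure_sigma_finite.

End cons_measure.

Fixpoint lebesgue_rV (n : nat) :
    {sigma_finite_measure set (borel 'rV[R]_n) -> \bar R} :=
  match n with
  | 0 => \d_(0 : borel 'rV[R]_0)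
  | n.+1 => cons_measure (lebesgue_rV n)
  end.

End lebesgue_rV.

Section calculus_rV.
Context {R : realType} {n : nat}.
Implicit Types (x : 'rV[R]_n) (f : 'rV[R]_n -> R) (U : set 'rV[R]_n).

Definition enorm x : R := Num.sqrt (\sum_i x 0 i ^+ 2).

Definition partial (i : 'I_n) f : 'rV[R]_n -> R :=
  fun x => 'D_(delta_mx 0 i : 'rV[R]_n) f x.

Definition iter_partial (s : seq 'I_n) f : 'rV[R]_n -> R := foldr partial f s.

(* On an open set this is being of class C^oo: every iterated partial
   derivative exists and is differentiable, hence continuous. *)
Definition smooth_on U f : Prop :=
  forall (s : seq 'I_n) x, U x -> differentiable (iter_partial s f) x.

(* f = O_k(|x|^a) as |x| -> oo; the list s ranges over the multi-indices. *)
Definition O_infty (k : nat) (a : R) f : Prop :=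
  forall s : seq 'I_n, (size s <= k)%N ->
  exists C rho : R, forall x, rho < enorm x ->
    `|iter_partial s f x| <= C * enorm x `^ (a - (size s)%:R).

(* The integral over the sphere of radius r for its Euclidean volume element,
   which is the cone measure A |-> (n / r) |{t x : 0 < t < 1, x in A}|. *)
Definition sphere_integral (r : R) f : R :=
  n%:R / r *
  \int[lebesgue_rV R n]_(x in [set x : 'rV[R]_n | enorm x < r])
     f ((r / enorm x) *: x).

End calculus_rV.

Section coordinate_curvature.
Context {R : realType} {n : nat}.
Variable G : 'rV[R]_n -> 'M[R]_n.
Implicit Types (f : 'rV[R]_n -> R) (i j k l : 'I_n).

Let g_ i j : 'rV[R]_n -> R := fun x => G x i j.

Definition inv_metric i j : 'rV[R]_n -> R := fun x => invmx (G x) i j.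

Definition christoffel k i j : 'rV[R]_n -> R := fun x =>
  2^-1 * \sum_l inv_metric k l x *
    (partial i (g_ j l) x + partial j (g_ i l) x - partial l (g_ i j) x).

Definition ricci_coord i j : 'rV[R]_n -> R := fun x =>
  \sum_k (partial k (christoffel k i j) x - partial j (christoffel k i k) x)
  + \sum_k \sum_l (christoffel k k l x * christoffel l i j x
                   - christoffel k j l x * christoffel l i k x).

Definition scalar_coord : 'rV[R]_n -> R := fun x =>
  \sum_i \sum_j inv_metric i j x * ricci_coord i j x.

Definition ricci_norm2_coord : 'rV[R]_n -> R := fun x =>
  \sum_i \sum_j \sum_k \sum_l
    inv_metric i k x * inv_metric j l x * ricci_coord i j x * ricci_coord k l x.

Definition laplacian_coord f : 'rV[R]_n -> R := fun x =>
  \sum_i \sum_j inv_metric i j x *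
    (partial i (partial j f) x - \sum_k christoffel k i j x * partial k f x).

Definition energy_density : 'rV[R]_n -> R := fun x =>
  \sum_j
   (\sum_i \sum_a partial j (partial i (partial i (g_ a a))) x
    - \sum_u \sum_i partial j (partial u (partial i (g_ u i))) x)
   * (x 0 j / enorm x).

End coordinate_curvature.

(* Only the values of chart_map on chart_dom and of chart_inv on chart_img are
   meaningful. *)
Record chart (R : realType) (n : nat) (T : topologicalType) := Chart {
  chart_dom : set T ;
  chart_img : set 'rV[R]_n ;
  chart_map : T -> 'rV[R]_n ;
  chart_inv : 'rV[R]_n -> T ;
  chart_dom_open : open chart_dom ;
  chart_img_open : open chart_img ;
  chart_map_img : forall p, chart_dom p -> chart_img (chart_map p) ;
  chart_inv_dom : forall x, chart_img x -> chart_dom (chart_inv x) ;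
  chart_mapK : forall p, chart_dom p -> chart_inv (chart_map p) = p ;
  chart_invK : forall x, chart_img x -> chart_map (chart_inv x) = x ;
  chart_map_continuous : forall p, chart_dom p -> {for p, continuous chart_map} ;
  chart_inv_continuous : forall x, chart_img x -> {for x, continuous chart_inv}
}.

Definition transition (R : realType) (n : nat) (T : topologicalType)
  (c c' : chart R n T) : 'rV[R]_n -> 'rV[R]_n := chart_map c' \o chart_inv c.

Definition overlap (R : realType) (n : nat) (T : topologicalType)
  (c c' : chart R n T) : set 'rV[R]_n :=
  [set x | chart_img c x /\ chart_dom c' (chart_inv c x)].

Definition compatible (R : realType) (n : nat) (T : topologicalType)
  (c c' : chart R n T) : Prop :=
  (forall j, smooth_on (overlap c c') (fun x => transition c c' x 0 j)) /\
  (forall j, smooth_on (overlap c' c) (fun x => transition c' c x 0 j)).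

(* The atlas is maximal, so atlas M c says that c is a smooth chart of M, i.e.
   a diffeomorphism from an open subset of M onto an open subset of R^n. *)
Record smooth_manifold (R : realType) (n : nat) := SmoothManifold {
  manifold_carrier :> ptopologicalType ;
  manifold_hausdorff : hausdorff_space manifold_carrier ;
  manifold_second_countable : @second_countable manifold_carrier ;
  atlas : set (chart R n manifold_carrier) ;
  atlas_cover : forall p, exists2 c, atlas c & chart_dom c p ;
  atlas_compatible : forall c c', atlas c -> atlas c' -> compatible c c' ;
  atlas_maximal : forall c, (forall c', atlas c' -> compatible c c') -> atlas c
}.

(* g c x is the matrix (g_ij(x)) in the coordinates of the chart c. *)
Record riemannian_metric (R : realType) (n : nat) (M : smooth_manifold R n) :=
  RiemannianMetric {
  metric_coord :> chart R n M -> 'rV[R]_n -> 'M[R]_n ;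
  metric_smooth : forall c, atlas c -> forall i j,
    smooth_on (chart_img c) (fun x => metric_coord c x i j) ;
  metric_symmetric : forall c, atlas c -> forall x, chart_img c x ->
    (metric_coord c x)^T = metric_coord c x ;
  metric_posdef : forall c, atlas c -> forall x, chart_img c x ->
    forall xi : 'rV[R]_n, xi != 0 -> 0 < (xi *m metric_coord c x *m xi^T) 0 0 ;
  metric_tensorial : forall c c', atlas c -> atlas c' ->
    forall x, overlap c c' x ->
    let J := jacobian (transition c c') x in
    metric_coord c x = J *m metric_coord c' (transition c c' x) *m J^T
}.

Section riemannian_geometry.
Context {R : realType} {n : nat} {M : smooth_manifold R n}.
Variable g : riemannian_metric M.
Implicit Types (c : chart R n M) (p q : M).

(* The common value of the coordinate expression F in all the charts around p;
   F is meant to be a tensorial expression, whose value does not depend on the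
   chart. *)
Definition chartwise (F : chart R n M -> R) p : R :=
  xget 0 [set s | forall c, atlas c -> chart_dom c p -> F c = s].

Definition scalar_curvature p : R :=
  chartwise (fun c => scalar_coord (g c) (chart_map c p)) p.

Definition ricci_norm2 p : R :=
  chartwise (fun c => ricci_norm2_coord (g c) (chart_map c p)) p.

Definition laplacian (f : M -> R) p : R :=
  chartwise (fun c => laplacian_coord (g c) (f \o chart_inv c) (chart_map c p)) p.

Definition Q_curvature p : R :=
  let N : R := n%:R in
  - (2 * (N - 1))^-1 * laplacian scalar_curvature p
  - 2 / (N - 2) ^+ 2 * ricci_norm2 p
  + (N ^+ 3 - 4 * N ^+ 2 + 16 * N - 16) / (8 * (N - 1) ^+ 2 * (N - 2) ^+ 2)
    * scalar_curvature p ^+ 2.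

(* mu is the Riemannian volume measure dV_g. *)
Definition riemannian_volume (mu : {measure set (borel M) -> \bar R}) : Prop :=
  forall c, atlas c -> forall A : set (borel M), measurable A ->
  A `<=` chart_dom c ->
  mu A = (\int[lebesgue_rV R n]_(x in chart_img c `&` chart_inv c @^-1` A)
            (Num.sqrt (\det (g c x)))%:E)%E.

(* gamma is of class C^1 on a neighbourhood of [0, 1]. *)
Definition C1_curve (gamma : R -> M) : Prop :=
  forall t : R, 0 <= t <= 1 ->
  {for t, continuous gamma} /\
  forall c, atlas c -> chart_dom c (gamma t) ->
    (\forall s \near t, derivable (chart_map c \o gamma) s 1) /\
    {for t, continuous (derive1 (chart_map c \o gamma))}.

Definition speed (gamma : R -> M) (t : R) : R :=
  chartwise (fun c =>
    let v := derive1 (chart_map c \o gamma) t in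
    Num.sqrt ((v *m g c (chart_map c (gamma t)) *m v^T) 0 0)) (gamma t).

Definition curve_length (gamma : R -> M) : R :=
  \int[lebesgue_measure]_(t in `[0, 1]) speed gamma t.

(* There is a piecewise C^1 curve of length L from p to q. *)
Inductive joined : M -> M -> R -> Prop :=
| joined_refl p : joined p p 0
| joined_step gamma q L : C1_curve gamma -> joined (gamma 1) q L ->
    joined (gamma 0) q (curve_length gamma + L).

Definition riem_dist p q : \bar R := ereal_inf [set L%:E | L in joined p q].

Definition complete_metric : Prop :=
  forall u : nat -> M,
  (forall e : R, 0 < e -> exists N : nat, forall k l : nat,
     (N <= k)%N -> (N <= l)%N -> (riem_dist (u k) (u l) < e%:E)%E) ->
  exists p, riem_dist (u k) p @[k --> \oo] --> 0%E.

Definition structure_at_infinity c : Prop :=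
  [/\ atlas c, compact (~` chart_dom c)
    & chart_img c = [set x | 1 < enorm x]].

(* g_ij = delta_ij + O_4(r^(- tau)) in the coordinates of c. *)
Definition flat_at_infinity (tau : R) c : Prop :=
  forall i j, O_infty 4 (- tau) (fun x => g c x i j - (i == j)%:R).

Definition asymptotically_euclidean : Prop :=
  complete_metric /\
  exists c, structure_at_infinity c /\
    (exists2 lambda : R, 1 < lambda & forall x, chart_img c x ->
       forall xi : 'rV[R]_n,
       lambda^-1 * enorm xi ^+ 2 <= (xi *m g c x *m xi^T) 0 0
         <= lambda * enorm xi ^+ 2) /\
    (exists2 tau : R, 0 < tau & flat_at_infinity tau c).

Definition critical_order : R := if (n <= 4)%N then 0 else n%:R / 2 - 2.

Definition admissible_structure c : Prop :=
  structure_at_infinity c /\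
  exists2 tau : R, critical_order < tau & flat_at_infinity tau c.

Definition is_fourth_order_energy (E : R) : Prop :=
  exists2 c, admissible_structure c &
    sphere_integral r (energy_density (g c)) @[r --> +oo] --> E.

End riemannian_geometry.

(* Main.v *)
Require Import Defs.
From mathcomp Require Import all_boot all_order all_algebra.
From mathcomp Require Import all_classical all_reals all_analysis.
From mathcomp Require Import measurable_realfun ring lra.

(** Write R for the scalar curvature and let e be the energy density, in a chart
    at infinity where g_ij - delta_ij = O_4(r^(-t)).  The linear part of R is
    the divergence expression d_i d_j g_ij - d_i d_i g_jj, and e is minus the
    radial derivative of that expression.  Everything else in R is at least
    quadratic in g - delta and its derivatives, hence O(r^(-2t-2)) together with
    one derivative at the corresponding rate, so that
      e = - (d R / d r) + O(r^(-2t-3))                [energy_density_scalar].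
    Over the sphere of radius r the error integrates to O(r^(n-4-2t)), which
    tends to 0 because t > n/2 - 2 when n >= 5, and t > 0 when n <= 4.

    Let A(r) be the integral of y |-> R(r y / |y|) over the punctured unit
    ball, a multiple of the mean of R over the sphere of radius r.
    Differentiating under the integral sign, A'(r) is the same mean of dR/dr
    [is_derive_sphere_mean], and by the dilation rule for Lebesgue measure the
    sphere integral of dR/dr is n r^(n-1) A'(r) [sphere_integralE].  If the
    limit E were negative, A' would therefore be positive for large r, so A
    would be strictly increasing there.  But A tends to 0, since
    R = O(r^(-t-2)), and A >= 0 for large r, since R > 0 near infinity: a
    contradiction [energy_ge0].

    It remains to see that R > 0 at all points of the chart with |x| large,
    that is, that a compact set K does not meet them [compact_avoided].  This
    uses the metric, because topologically the complement of the chart could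
    well contain a point at infinity.  By compactness it is enough that |x| is
    bounded near each point p.  If p is outside the chart, join a nearby point q
    of the chart to p by a segment in another chart.  The metric being close to
    the Euclidean one for |x| large, the coordinates x move along the segment
    with bounded speed; if |x(q)| is larger than this bound plus a constant,
    the curve stays in a compact part of the chart and never reaches p
    [segment_bounded].

    The independence of R of the chart is not needed: a positive value of the
    scalar curvature at p is already the common value of its coordinate
    expressions in all the charts around p. *)

Set Implicit Arguments.
Unset Strict Implicit.
Unset Printing Implicit Defensive.

Import Order.TTheory GRing.Theory Num.Theory.
Import numFieldNormedType.Exports.

Local Open Scope classical_set_scope.
Local Open Scope ring_scope.

(** * The Euclidean norm and symbol classes near infinity *)

Section enorm_theory.
Context {R : realType} {n : nat}.
Implicit Types x : 'rV[R]_n.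

Lemma enorm_ge0 x : 0 <= enorm x.
Proof. exact: sqrtr_ge0. Qed.

Lemma enormZ (a : R) x : enorm (a *: x) = `|a| * enorm x.
Proof.
rewrite /enorm; under eq_bigr do rewrite mxE exprMn.
by rewrite -mulr_sumr sqrtrM ?sqr_ge0// sqrtr_sqr.
Qed.

Lemma enorm0 : enorm (0 : 'rV[R]_n) = 0.
Proof. by rewrite -(scale0r (0 : 'rV[R]_n)) enormZ normr0 mul0r. Qed.

Lemma ler_coord_enorm x i : `|x 0 i| <= enorm x.
Proof.
rewrite -sqrtr_sqr ler_sqrt ?sumr_ge0// => [|j _]; last exact: sqr_ge0.
by rewrite (bigD1 i)//= lerDl sumr_ge0// => j _; exact: sqr_ge0.
Qed.

Lemma enorm_eq0 x : (enorm x == 0) = (x == 0).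
Proof.
apply/idP/eqP => [/eqP x0|->]; last by rewrite enorm0.
apply/rowP => i; rewrite mxE; apply/eqP; rewrite -normr_le0 -x0.
exact: ler_coord_enorm.
Qed.

Lemma enorm_gt0 x : (0 < enorm x) = (x != 0).
Proof. by rewrite lt_def enorm_eq0 enorm_ge0 andbT. Qed.

Lemma continuous_enorm : continuous (@enorm R n).
Proof.
move=> x; apply: (@continuous_comp _ _ _ (fun x : 'rV[R]_n => \sum_i x 0 i ^+ 2)
  (@Num.sqrt R)); last exact: sqrt_continuous.
apply: (@continuous_big _ _ _ _ xpredT (@add_continuous R)) => i _ {}x.
apply: (@continuous_comp _ _ _ (fun x : 'rV[R]_n => x 0 i) (fun y : R => y ^+ 2)).
  exact: coord_continuous.
exact: exprn_continuous.
Qed.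

Lemma open_enorm_gt (r : R) : open [set x : 'rV[R]_n | r < enorm x].
Proof.
apply: (@open_comp _ _ (@enorm R n) [set y | r < y]); last exact: open_gt.
by move=> x _; exact: continuous_enorm.
Qed.

Lemma open_enorm_lt (r : R) : open [set x : 'rV[R]_n | enorm x < r].
Proof.
apply: (@open_comp _ _ (@enorm R n) [set y | y < r]); last exact: open_lt.
by move=> x _; exact: continuous_enorm.
Qed.

End enorm_theory.

Section big_oh.
Context {R : realType} {n : nat}.
Implicit Types (f h : 'rV[R]_n -> R) (a b : R).

(** [f] is O(|x|^a) as |x| tends to infinity. *)
Definition big_oh a f : Prop :=
  exists C rho : R, forall x, rho < enorm x -> `|f x| <= C * enorm x `^ a.

Lemma big_oh_pos a f : big_oh a f -> exists C rho : R, [/\ 0 < C, 1 <= rho &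
  forall x, rho < enorm x -> `|f x| <= C * enorm x `^ a].
Proof.
move=> [C [rho h]]; exists (Num.max C 1), (Num.max rho 1); split.
- by rewrite lt_max ltr01 orbT.
- by rewrite le_max lexx orbT.
move=> x; rewrite gt_max => /andP[rx _]; apply: (le_trans (h _ rx)).
by rewrite ler_wpM2r ?powR_ge0// le_max lexx.
Qed.

Lemma big_oh_le a b f : a <= b -> big_oh a f -> big_oh b f.
Proof.
move=> ab /big_oh_pos[C [rho [C0 r1 h]]]; exists C, rho => x rx.
rewrite (le_trans (h _ rx))// ler_wpM2l ?(ltW C0)// ler_powR//.
exact/ltW/(le_lt_trans r1).
Qed.

Lemma big_oh_near a f h : (forall x, 1 < enorm x -> f x = h x) ->
  big_oh a f -> big_oh a h.
Proof.
pose r : R := 1; move=> fh [C [rho H]]; exists C, (Num.max r rho) => x.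
by rewrite gt_max => /andP[rx rhox]; rewrite -fh//; exact: H.
Qed.

Lemma big_ohD a f h : big_oh a f -> big_oh a h -> big_oh a (fun x => f x + h x).
Proof.
move=> [C [rho H]] [C' [rho' H']]; exists (C + C'), (Num.max rho rho') => x.
rewrite gt_max => /andP[/H xC /H' xC'].
by rewrite mulrDl (le_trans (ler_normD _ _))// lerD.
Qed.

Lemma big_ohN a f : big_oh a f -> big_oh a (fun x => - f x).
Proof. by move=> [C [rho H]]; exists C, rho => x /H; rewrite normrN. Qed.

Lemma big_oh0 a : big_oh a (fun=> 0).
Proof.
by exists 0, 0 => x _; rewrite normr0 mul0r.
Qed.

Lemma big_ohM a b f h : big_oh a f -> big_oh b h -> big_oh (a + b) (fun x => f x * h x).
Proof.
move=> /big_oh_pos[C [rho [C0 r1 H]]] /big_oh_pos[C' [rho' [C'0 r'1 H']]].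
exists (C * C'), (Num.max rho rho') => x.
rewrite gt_max => /andP[rx r'x]; rewrite powRD; last first.
  by apply/implyP => _; rewrite gt_eqF// (lt_trans ltr01)// (le_lt_trans r1).
by rewrite mulrACA normrM ler_pM// ?H ?H'.
Qed.

Lemma big_oh_cst (c : R) : big_oh 0 (fun=> c).
Proof. by exists `|c|, 0 => x _; rewrite powRr0 mulr1. Qed.

Lemma big_oh_sum (I : Type) (s : seq I) (P : pred I) a (F : I -> 'rV[R]_n -> R) :
  (forall i, P i -> big_oh a (F i)) -> big_oh a (fun x => \sum_(i <- s | P i) F i x).
Proof.
move=> H; elim: s => [|i s ih].
  by apply: big_oh_near (big_oh0 a) => x _; rewrite big_nil.
have [Pi|NPi] := boolP (P i); last first.
  by apply: big_oh_near ih => x _; rewrite big_cons (negbTE NPi).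
by apply: big_oh_near (big_ohD (H _ Pi) ih) => x _; rewrite big_cons Pi.
Qed.

(** A negative power of a large number is small. *)
Lemma powR_small a (e : R) : a < 0 -> 0 < e ->
  exists rho : R, 1 <= rho /\ forall r, rho < r -> r `^ a < e.
Proof.
move=> a0 e0; exists (Num.max 1 (e `^ a^-1)); split; first by rewrite le_max lexx.
move=> r; rewrite gt_max => /andP[r1 er].
have r0 : 0 < r by exact: lt_trans r1.
suff : r `^ a < (e `^ a^-1) `^ a.
  by rewrite -powRrM mulVf ?lt_eqF// powRr1// ltW.
have inv (y : R) : y `^ a = (y `^ (- a))^-1 by rewrite -powRN opprK.
rewrite inv [ltRHS]inv ltf_pV2 ?posrE ?powR_gt0//.
by rewrite gt0_ltr_powR// ?oppr_gt0// ?nnegrE ?powR_ge0// ltW.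
Qed.

Lemma big_oh_small a f (e : R) : a < 0 -> 0 < e -> big_oh a f ->
  exists rho : R, 1 <= rho /\ forall x, rho < enorm x -> `|f x| < e.
Proof.
move=> a0 e0 /big_oh_pos[C [rho [C0 r1 H]]].
have [rho' [r'1 H']] := powR_small a0 (divr_gt0 e0 C0).
exists (Num.max rho rho'); split; first by rewrite le_max r1.
move=> x; rewrite gt_max => /andP[rx r'x]; apply: (le_lt_trans (H _ rx)).
by rewrite mulrC -ltr_pdivlMr// H'.
Qed.

End big_oh.

Section differentiable_near.
Context {R : realType} {V W : normedModType R}.

(** Together with [h = f + (h - f)], this case gives the locality of
    differentiability. *)
Lemma differentiable_near0 (f : V -> W) x :
  (\forall y \near x, f y = 0) -> differentiable f x.
Proof.
move=> f0.
have fs : f \o shift x = cst (f x) + (\0 : V -> W) +o_ 0 id.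
  apply/eqaddoP => e e0; rewrite (nbhs_singleton f0).
  have := f0; rewrite (near_shift 0) subr0 => f0'.
  near=> y; rewrite !fctE addr0 subr0.
  have -> : f (shift x y) = 0 by near: y.
  by rewrite normr0 mulr_ge0// ltW.
have d0 : 'd f x = (\0 : {linear V -> W}) :> (V -> W).
  by apply: diff_unique => //; exact: cst_continuous.
by apply/diff_locallyP; rewrite d0; split => //; exact: cst_continuous.
Unshelve. all: by end_near. Qed.

Lemma near_eq_differentiable (f h : V -> W) x : (\forall y \near x, f y = h y) ->
  differentiable f x -> differentiable h x.
Proof.
move=> fh df; have -> : h = f + (h - f) by rewrite addrC subrK.
apply: differentiableD => //; apply: differentiable_near0.
by apply: filterS fh => y fhy; rewrite !fctE fhy subrr.
Qed.

End differentiable_near.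

Section symbol.
Context {R : realType} {n : nat}.
Implicit Types (f h : 'rV[R]_n -> R) (a b : R) (k : nat).

(** The exterior of the closed unit ball, the image of a chart at infinity. *)
Definition far : set 'rV[R]_n := [set x | 1 < enorm x].

(** The symbols of order [a], with [k] derivatives: the partial derivatives of
    [f] of every length [l <= k] are differentiable on [far] and are
    O(|x|^(a - l)).  The recursion peels off the innermost derivative, and
    depends on [f] only through its values on [far]. *)
Fixpoint symbol k a f : Prop :=
  [/\ forall x, far x -> differentiable f x, big_oh a f &
      if k is k'.+1 then forall i, symbol k' (a - 1) (partial i f) else True].

Lemma symbol_diff k a f : symbol k a f -> forall x, far x -> differentiable f x.
Proof. by case: k => [|k] []. Qed.

Lemma symbol_big_oh k a f : symbol k a f -> big_oh a f.
Proof. by case: k => [|k] []. Qed.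

Lemma symbol_partial k a f i : symbol k.+1 a f -> symbol k (a - 1) (partial i f).
Proof. by case=> _ _; exact. Qed.

Lemma near_far (T : Type) (f h : 'rV[R]_n -> T) x : far x -> (forall y, far y -> f y = h y) ->
  \forall y \near x, f y = h y.
Proof.
move=> fx fh; have : nbhs x far by apply: open_nbhs_nbhs; split => //; exact: open_enorm_gt.
by apply: filterS => y; exact: fh.
Qed.

Lemma partial_far i f h : (forall x, far x -> f x = h x) ->
  forall x, far x -> partial i f x = partial i h x.
Proof. by move=> fh x fx; apply: near_eq_derive; exact: near_far. Qed.

Lemma symbol_ext k a f h : (forall x, far x -> f x = h x) ->
  symbol k a f -> symbol k a h.
Proof.
elim: k a f h => [|k ih] a f h fh [df Of pf]; split.
- by move=> x fx; apply: near_eq_differentiable (df _ fx); exact: near_far.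
- exact: big_oh_near Of.
- by [].
- by move=> x fx; apply: near_eq_differentiable (df _ fx); exact: near_far.
- exact: big_oh_near Of.
- by move=> i; apply: ih (pf i); exact: partial_far.
Qed.

Lemma symbol_le a b k f : a <= b -> symbol k a f -> symbol k b f.
Proof.
elim: k a b f => [|k ih] a b f ab [df Of pf]; split=> //.
- exact: big_oh_le Of.
- exact: big_oh_le Of.
- by move=> i; apply: ih (pf i); rewrite lerD2r.
Qed.

Lemma symbolS k a f : symbol k.+1 a f -> symbol k a f.
Proof.
by elim: k a f => [|k ih] a f [df Of pf]; split=> // i; exact/ih/pf.
Qed.

Lemma partial_cst (c : R) i : partial i (fun=> c) = (fun=> 0) :> ('rV[R]_n -> R).
Proof. by apply/funext => x; exact: derive_cst. Qed.

Lemma symbol0 k a : symbol k a (fun=> 0).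
Proof.
elim: k a => [|k ih] a; split=> //; do ?[exact: big_oh0|by move=> *; exact: differentiable_cst].
by move=> i; rewrite partial_cst.
Qed.

Lemma symbol_cst k c : symbol k 0 (fun=> c).
Proof.
case: k => [|k]; split=> //; do ?[exact: big_oh_cst|by move=> *; exact: differentiable_cst].
by move=> i; rewrite partial_cst; exact: symbol0.
Qed.

Lemma partialD i f h x : differentiable f x -> differentiable h x ->
  partial i (fun x => f x + h x) x = partial i f x + partial i h x.
Proof. by move=> df dh; apply: deriveD; exact: diff_derivable. Qed.

Lemma partialN i f x : differentiable f x ->
  partial i (fun x => - f x) x = - partial i f x.
Proof. by move=> df; apply: deriveN; exact: diff_derivable. Qed.

Lemma partialM i f h x : differentiable f x -> differentiable h x ->
  partial i (fun x => f x * h x) x = f x * partial i h x + h x * partial i f x.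
Proof. by move=> df dh; apply: deriveM; exact: diff_derivable. Qed.

Lemma partialV i f x : differentiable f x -> f x != 0 ->
  partial i (fun x => (f x)^-1) x = - ((f x)^-1 * (f x)^-1) * partial i f x.
Proof.
move=> df f0; rewrite -invfM -expr2.
by apply: deriveV => //; exact: diff_derivable.
Qed.

Lemma symbolD k a f h : symbol k a f -> symbol k a h ->
  symbol k a (fun x => f x + h x).
Proof.
elim: k a f h => [|k ih] a f h [df Of pf] [dh Oh ph]; split=> //;
  do ?[exact: big_ohD|by move=> x fx; apply: differentiableD; [exact: df|exact: dh]].
move=> i; apply: symbol_ext (ih _ _ _ (pf i) (ph i)) => x fx.
by rewrite partialD//; [exact: df|exact: dh].
Qed.

Lemma symbolN k a f : symbol k a f -> symbol k a (fun x => - f x).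
Proof.
elim: k a f => [|k ih] a f [df Of pf]; split=> //;
  do ?[exact: big_ohN|by move=> x fx; apply: differentiableN; exact: df|exact: I].
move=> i; apply: symbol_ext (ih _ _ (pf i)) => x fx.
by rewrite partialN//; exact: df.
Qed.

Lemma symbolB k a f h : symbol k a f -> symbol k a h ->
  symbol k a (fun x => f x - h x).
Proof. by move=> sf /symbolN; exact: symbolD. Qed.

Lemma symbolM k a b f h : symbol k a f -> symbol k b h ->
  symbol k (a + b) (fun x => f x * h x).
Proof.
elim: k a b f h => [|k ih] a b f h sf sh.
  have [df Of _] := sf; have [dh Oh _] := sh; split=> //; last exact: big_ohM.
  by move=> x fx; apply: differentiableM; [exact: df|exact: dh].
have [df Of pf] := sf; have [dh Oh ph] := sh; split; last 2 first.
- exact: big_ohM.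
- move=> i; apply: (@symbol_ext _ _ (fun x => f x * partial i h x + h x * partial i f x)).
    by move=> x fx; rewrite partialM//; [exact: df|exact: dh].
  apply: symbolD.
    by rewrite -addrA; apply: ih (ph i); exact: symbolS.
  by rewrite -addrA addrCA; apply: ih (pf i); exact: symbolS.
by move=> x fx; apply: differentiableM; [exact: df|exact: dh].
Qed.

(** Multiplication by a function of nonpositive order preserves symbols. *)
Lemma symbolMl k a b f h : a <= 0 -> symbol k a f -> symbol k b h ->
  symbol k b (fun x => f x * h x).
Proof.
move=> a0 sf sh; apply: (@symbol_le (a + b)); last exact: symbolM.
by rewrite gerDr.
Qed.

Lemma symbolZ k a (c : R) f : symbol k a f -> symbol k a (fun x => c * f x).
Proof. by move=> sf; apply: symbolMl (symbol_cst _ _) sf. Qed.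

Lemma symbol_sum (I : Type) (s : seq I) (P : pred I) k a (F : I -> 'rV[R]_n -> R) :
  (forall i, P i -> symbol k a (F i)) ->
  symbol k a (fun x => \sum_(i <- s | P i) F i x).
Proof.
move=> H; elim: s => [|i s ih].
  by apply: symbol_ext (symbol0 k a) => x _; rewrite big_nil.
have [Pi|NPi] := boolP (P i); last first.
  by apply: symbol_ext ih => x _; rewrite big_cons (negbTE NPi).
by apply: symbol_ext (symbolD (H _ Pi) ih) => x _; rewrite big_cons Pi.
Qed.

Lemma big_ohV f : (exists2 e : R, 0 < e & exists rho, forall x, rho < enorm x -> e <= `|f x|) ->
  big_oh 0 (fun x => (f x)^-1).
Proof.
move=> [e e0 [rho H]]; exists e^-1, rho => x /H ef.
by rewrite powRr0 mulr1 normfV lef_pV2// posrE// (lt_le_trans e0).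
Qed.

(** The inverse of a symbol of order 0 that is bounded away from 0 is again one:
    the derivative of [f^-1] is [- f^-1 * f^-1] times that of [f], and [f^-1] is
    a symbol with one derivative less by induction. *)
Lemma symbolV k f :
  (forall x, far x -> f x != 0) ->
  (exists2 e : R, 0 < e & exists rho, forall x, rho < enorm x -> e <= `|f x|) ->
  symbol k 0 f -> symbol k 0 (fun x => (f x)^-1).
Proof.
move=> f0 fe; have OV := big_ohV fe.
have dV : (forall x, far x -> differentiable f x) ->
    forall x, far x -> differentiable (fun x => (f x)^-1) x.
  by move=> H x fx; apply: differentiableV; [exact: H|exact: f0].
elim: k => [|k ih] [df Of pf]; split=> //; do ?exact: dV.
have {}ih : symbol k 0 (fun x => (f x)^-1).
  by apply: ih; apply: symbolS; split.
move=> i; apply: (@symbol_ext _ _ (fun x => - ((f x)^-1 * (f x)^-1) * partial i f x)).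
  by move=> x fx; rewrite partialV//; [exact: df|exact: f0].
apply: (@symbolMl _ 0) => //.
  by apply/symbolN; apply: (@symbolMl _ 0).
exact: pf.
Qed.

(** [f = c + O_k(|x|^a)] near infinity. *)
Definition asymptotic k a (c : R) f := symbol k a (fun x => f x - c).

Lemma asymptotic_ext k a c f h : (forall x, far x -> f x = h x) ->
  asymptotic k a c f -> asymptotic k a c h.
Proof. by move=> fh; apply: symbol_ext => x fx; rewrite fh. Qed.

Lemma asymptotic_symbol k a c f : a <= 0 -> asymptotic k a c f -> symbol k 0 f.
Proof.
move=> a0 /(symbol_le a0) sf.
by apply: symbol_ext (symbolD sf (symbol_cst k c)) => x _; rewrite subrK.
Qed.

Lemma asymptotic_cst k a c : asymptotic k a c (fun=> c).
Proof. by apply: symbol_ext (symbol0 k a) => x _; rewrite subrr. Qed.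

Lemma asymptoticM k a c d f h : a <= 0 ->
  asymptotic k a c f -> asymptotic k a d h ->
  asymptotic k a (c * d) (fun x => f x * h x).
Proof.
move=> a0 sf sh; have := symbolD (symbolMl a0 sf sh)
  (symbolD (symbolZ c sh) (symbolZ d sf)).
by apply: symbol_ext => x _; ring.
Qed.

Lemma asymptotic_sum (I : Type) (s : seq I) k a (c : I -> R)
    (F : I -> 'rV[R]_n -> R) :
  (forall i, asymptotic k a (c i) (F i)) ->
  asymptotic k a (\sum_(i <- s) c i) (fun x => \sum_(i <- s) F i x).
Proof.
move=> H; have := @symbol_sum _ s xpredT _ _ _ (fun i _ => H i).
by apply: symbol_ext => x _; rewrite -sumrB.
Qed.

Lemma asymptotic_prod (I : Type) (s : seq I) k a (c : I -> R)
    (F : I -> 'rV[R]_n -> R) : a <= 0 ->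
  (forall i, asymptotic k a (c i) (F i)) ->
  asymptotic k a (\prod_(i <- s) c i) (fun x => \prod_(i <- s) F i x).
Proof.
move=> a0 H; elim: s => [|i s ih].
  by rewrite big_nil; apply: asymptotic_ext (asymptotic_cst k a 1) => x _; rewrite big_nil.
rewrite big_cons; apply: asymptotic_ext (asymptoticM a0 (H i) ih) => x _.
by rewrite big_cons.
Qed.

Lemma asymptotic_det m k a (c : 'M[R]_m) (F : 'rV[R]_n -> 'M[R]_m) : a <= 0 ->
  (forall i j, asymptotic k a (c i j) (fun x => F x i j)) ->
  asymptotic k a (\det c) (fun x => \det (F x)).
Proof.
move=> a0 H; rewrite /determinant; apply: asymptotic_sum => s.
apply: asymptoticM => //; first exact: asymptotic_cst.
exact: asymptotic_prod.
Qed.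

Lemma symbol_of_O_infty k a f :
  (forall s, (size s <= k)%N -> forall x, far x -> differentiable (iter_partial s f) x) ->
  O_infty k a f -> symbol k a f.
Proof.
elim: k a f => [|k ih] a f df Of; split => //; do ?exact: (df [::]).
- by have := Of [::] isT; rewrite subr0.
- by have := Of [::] isT; rewrite subr0.
move=> i; apply: ih => s sk.
  move=> x fx; have := df (rcons s i); rewrite size_rcons ltnS.
  by rewrite /iter_partial foldr_rcons; exact.
have := Of (rcons s i); rewrite [size _]size_rcons ltnS => /(_ sk).
rewrite /iter_partial foldr_rcons.
by rewrite (_ : a - 1 - (size s)%:R = a - (size s).+1%:R)// -[(size s).+1]add1n natrD; ring.
Qed.

End symbol.

(** * Curvature of an asymptotically flat metric in coordinates *)

Section curvature_asymptotics.
Context {R : realType} {n : nat}.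
Variables (G : 'rV[R]_n -> 'M[R]_n) (t : R).
Hypothesis t0 : 0 < t.
Hypothesis G_asymp : forall i j, asymptotic 4 (- t) (i == j)%:R (fun x => G x i j).
Hypothesis G_det : forall x, far x -> \det (G x) != 0.
Hypothesis G_sym : forall x, far x -> (G x)^T = G x.
Implicit Types (x : 'rV[R]_n) (i j k l : 'I_n).

Let Nt : - t <= 0. Proof. by rewrite oppr_le0 ltW. Qed.

Let g i j x : R := G x i j.

(** The partial derivatives do not see the constant in an asymptotic expansion. *)
Lemma partial_asymptotic (m : nat) a c f i :
  asymptotic m.+1 a c f -> symbol m (a - 1) (partial (R := R) (n := n) i f).
Proof.
move=> af; have := symbol_partial i af; apply: symbol_ext => x fx.
have df : differentiable f x.
  have := symbol_diff af fx => d; have -> : f = (fun x => (f x - c) + c).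
    by apply/funext => y; rewrite subrK.
  by apply: differentiableD => //; exact: differentiable_cst.
rewrite [LHS](@partialD _ _ i f (fun=> - c))//.
by rewrite partial_cst addr0.
Qed.

Lemma partial_sum (I : Type) (s : seq I) (F : I -> 'rV[R]_n -> R) i x :
  (forall u, differentiable (F u) x) ->
  partial i (fun x => \sum_(u <- s) F u x) x = \sum_(u <- s) partial i (F u) x.
Proof.
move=> dF.
have [] : differentiable (fun x => \sum_(u <- s) F u x) x /\
    partial i (fun x => \sum_(u <- s) F u x) x = \sum_(u <- s) partial i (F u) x.
  elim: s => [|u s [ds ih]].
    rewrite big_nil (_ : (fun x => _) = cst 0); last first.
      by apply/funext => y; rewrite big_nil.
    by rewrite partial_cst; split => //; exact: differentiable_cst.
  rewrite big_cons (_ : (fun x => _) = (fun x => F u x + \sum_(u <- s) F u x)); last first.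
    by apply/funext => y; rewrite big_cons.
  by rewrite partialD// ih; split => //; exact: differentiableD.
by [].
Qed.

(** The determinant tends to [\det 1 = 1], hence stays away from 0. *)
Lemma symbol_det_inv : symbol 4 0 (fun x => (\det (G x))^-1).
Proof.
have ad : asymptotic 4 (- t) (1 : R) (fun x => \det (G x)).
  have := @asymptotic_det _ _ n 4 _ 1%:M G Nt; rewrite det1; apply => i j.
  by rewrite mxE; exact: G_asymp.
apply: symbolV; [exact: G_det| |exact: asymptotic_symbol Nt ad].
exists 2^-1 => //.
have Nt' : - t < 0 by rewrite oppr_lt0.
have h2 : 0 < 2^-1 :> R by rewrite invr_gt0.
have [rho [_ H]] := big_oh_small Nt' h2 (symbol_big_oh ad).
exists rho => x /H; rewrite ltr_norml => /andP[h _].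
by rewrite ler_normr; apply/orP; left; lra.
Qed.

Lemma symbol_cofactor i j : symbol 4 0 (fun x => cofactor (G x) i j).
Proof.
apply: (@symbolZ _ _ _ _ _ (fun x => \det (row' i (col' j (G x))))).
apply: (@asymptotic_symbol _ _ _ (- t) (\det (row' i (col' j 1%:M)))) => //.
by apply: asymptotic_det => // u v; rewrite !mxE; apply: asymptotic_ext (G_asymp _ _) => x _; rewrite !mxE.
Qed.

Lemma symbol_inv_metric i j : symbol 4 0 (inv_metric G i j).
Proof.
apply: symbol_ext (symbolMl (lexx 0) symbol_det_inv (symbol_cofactor j i)) => x fx.
by rewrite /inv_metric /invmx unitmxE unitfE G_det// !mxE.
Qed.

(** From [1 - g^-1 = g^-1 (g - 1)]. *)
Lemma asymptotic_inv_metric i j : asymptotic 4 (- t) (i == j)%:R (inv_metric G i j).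
Proof.
have : symbol 4 (- t) (fun x => - \sum_l inv_metric G i l x * (g l j x - (l == j)%:R)).
  apply/symbolN/symbol_sum => l _; apply: symbolMl (symbol_inv_metric _ _) _ => //.
  exact: G_asymp.
apply: symbol_ext => x fx.
have : (invmx (G x) *m (G x - 1%:M)) i j = (1%:M - invmx (G x)) i j.
  by rewrite mulmxBr mulmx1 mulVmx// unitmxE unitfE G_det.
rewrite !mxE => H.
rewrite -(opprB (i == j)%:R); congr (- _); rewrite -[RHS]H.
by apply: eq_bigr => l _; rewrite /g !mxE.
Qed.

Lemma symbol_dmetric i j k : symbol 3 (- t - 1) (partial i (g j k)).
Proof. exact: partial_asymptotic (G_asymp j k). Qed.

Let D i j l x := partial i (g j l) x + partial j (g i l) x - partial l (g i j) x.

Let symbol_D i j l : symbol 3 (- t - 1) (D i j l).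
Proof. by apply: symbolB; [apply: symbolD|]; exact: symbol_dmetric. Qed.

(** The part of the Christoffel symbols that is linear in the metric, with the
    inverse metric replaced by the identity. *)
Definition christoffel_lin k i j x : R := 2^-1 * D i j k x.

Lemma symbol_christoffel_lin k i j : symbol 3 (- t - 1) (christoffel_lin k i j).
Proof. exact: symbolZ. Qed.

Lemma symbol_christoffel k i j : symbol 3 (- t - 1) (christoffel G k i j).
Proof.
apply: symbolZ; apply: symbol_sum => l _; apply: symbolMl (symbol_D _ _ _) => //.
exact/symbolS/symbol_inv_metric.
Qed.

Lemma symbol_christoffel_quad k i j : symbol 3 (- t - (t + 1))
  (fun x => christoffel G k i j x - christoffel_lin k i j x).
Proof.
have : symbol 3 (- t - (t + 1)) (fun x => 2^-1 * \sum_l (inv_metric G k l x - (k == l)%:R) * D i j l x).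
  apply: symbolZ; apply: symbol_sum => l _.
  rewrite opprD; apply: symbolM (symbol_D _ _ _).
  exact/symbolS/asymptotic_inv_metric.
apply: symbol_ext => x _.
rewrite /christoffel /christoffel_lin -mulrBr; congr (_ * _).
have -> : D i j k x = \sum_l (k == l)%:R * D i j l x.
  rewrite (bigD1 k)//= eqxx mul1r big1 ?addr0// => l lk.
  by rewrite eq_sym (negbTE lk) mul0r.
by rewrite -sumrB; apply: eq_bigr => l _; rewrite mulrBl.
Qed.

(** The part of the Ricci tensor that is linear in the metric. *)
Definition ricci_lin i j x : R :=
  \sum_k (partial k (christoffel_lin k i j) x - partial j (christoffel_lin k i k) x).

Lemma symbol_ricci_lin i j : symbol 2 (- t - 2) (ricci_lin i j).
Proof.
have -> : - t - 2 = - t - 1 - 1 by ring.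
apply: symbol_sum => k _; apply: symbolB; apply: symbol_partial;
exact: symbol_christoffel_lin.
Qed.

(** The nonlinear part of the Ricci tensor decays twice as fast in [t]. *)
Lemma symbol_ricci_quad i j :
  symbol 2 (- t - (t + 2)) (fun x => ricci_coord G i j x - ricci_lin i j x).
Proof.
have e1 : - t - (t + 2) = - t - (t + 1) - 1 by ring.
have e2 : - t - (t + 2) = (- t - 1) + (- t - 1) by ring.
pose Q k i j x := christoffel G k i j x - christoffel_lin k i j x.
have sc k u v := symbolS (symbol_christoffel k u v).
have : symbol 2 (- t - (t + 2)) (fun x =>
    \sum_k (partial k (Q k i j) x - partial j (Q k i k) x) +
    \sum_k \sum_l (christoffel G k k l x * christoffel G l i j x
                   - christoffel G k j l x * christoffel G l i k x)).
  apply: symbolD.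
    by apply: symbol_sum => k _; rewrite e1; apply: symbolB; apply: symbol_partial;
      exact: symbol_christoffel_quad.
  apply: symbol_sum => k _; apply: symbol_sum => l _; rewrite e2.
  by apply: symbolB; apply: symbolM; exact: sc.
apply: symbol_ext => x fx; rewrite /ricci_coord /ricci_lin.
rewrite [RHS]addrAC; congr (_ + _); rewrite -sumrB; apply: eq_bigr => k _.
have dc u v w := symbol_diff (symbol_christoffel u v w) fx.
have dl u v w := symbol_diff (symbol_christoffel_lin u v w) fx.
have pQ l u v w : partial l (Q u v w) x =
    partial l (christoffel G u v w) x - partial l (christoffel_lin u v w) x.
  rewrite [LHS](@partialD _ _ l (christoffel G u v w) (fun x => - christoffel_lin u v w x))//.
    by rewrite partialN.
  exact: differentiableN.
have sub4 (a b c d : R) : a - b - (c - d) = a - c - (b - d) by ring.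
by rewrite !pQ; exact: sub4.
Qed.

(** The part of the scalar curvature that is linear in the metric. *)
Definition scalar_lin x : R := \sum_i ricci_lin i i x.

Lemma symbol_scalar_quad :
  symbol 2 (- t - (t + 2)) (fun x => scalar_coord G x - scalar_lin x).
Proof.
have : symbol 2 (- t - (t + 2)) (fun x => \sum_i \sum_j (
    inv_metric G i j x * (ricci_coord G i j x - ricci_lin i j x)
    + (inv_metric G i j x - (i == j)%:R) * ricci_lin i j x)).
  apply: symbol_sum => i _; apply: symbol_sum => j _; apply: symbolD.
    by apply: symbolMl (symbol_ricci_quad _ _) => //; exact/symbolS/symbolS/symbol_inv_metric.
  rewrite (_ : - t - (t + 2) = - t + (- t - 2)); last by ring.
  apply: symbolM; first exact/symbolS/symbolS/asymptotic_inv_metric.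
  exact: symbol_ricci_lin.
apply: symbol_ext => x _; rewrite /scalar_coord /scalar_lin -sumrB.
apply: eq_bigr => i _.
have -> : ricci_lin i i x = \sum_j (i == j)%:R * ricci_lin i j x.
  rewrite (bigD1 i)//= eqxx mul1r big1 ?addr0// => l lk.
  by rewrite eq_sym (negbTE lk) mul0r.
by rewrite -sumrB; apply: eq_bigr => j _; ring.
Qed.

(** The function whose radial derivative is the density of the energy. *)
Definition energy_potential x : R :=
  \sum_i \sum_a partial i (partial i (g a a)) x
  - \sum_u \sum_i partial u (partial i (g u i)) x.

Lemma symbol_ddmetric i j k l : symbol 2 (- t - 2) (partial i (partial j (g k l))).
Proof.
rewrite (_ : - t - 2 = - t - 1 - 1); last by ring.
exact/symbol_partial/symbol_dmetric.
Qed.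

(* The index bookkeeping of [scalar_linE], for abstract families in place of the
   second derivatives of the metric. *)
Let sum_scalar_lin (A C : 'I_n -> 'I_n -> R) :
  \sum_i \sum_k (A k i - 2^-1 * C k i - 2^-1 * C i k) =
  \sum_u \sum_i A u i - \sum_i \sum_a C i a.
Proof.
transitivity (\sum_i \sum_k A k i - (2^-1 * (\sum_i \sum_k C k i) +
  2^-1 * (\sum_i \sum_k C i k))).
  rewrite !mulr_sumr -big_split/= -sumrB; apply: eq_bigr => i _.
  rewrite !mulr_sumr -big_split/= -sumrB; apply: eq_bigr => k _.
  by rewrite opprD addrA.
rewrite exchange_big/= [X in _ * X + _]exchange_big/= -mulrDl.
by rewrite -[2^-1]mul1r -splitr mul1r.
Qed.

(** The symmetry of the metric identifies the two mixed divergence terms. *)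
Lemma scalar_linE x : far x -> scalar_lin x = - energy_potential x.
Proof.
move=> fx; rewrite /scalar_lin /ricci_lin /energy_potential opprB.
have dg i j k := symbol_diff (symbol_dmetric i j k) fx.
have c1 i k : partial k (christoffel_lin k i i) x =
    partial k (partial i (g i k)) x - 2^-1 * partial k (partial k (g i i)) x.
  rewrite (_ : christoffel_lin k i i = (fun x => partial i (g i k) x + - (2^-1 * partial k (g i i) x))); last first.
    by apply/funext => y; rewrite /christoffel_lin /D; field.
  have dZ : differentiable (fun x => 2^-1 * partial k (g i i) x) x.
    by apply: differentiableM => //; exact: differentiable_cst.
  rewrite partialD//; last exact: differentiableN.
  rewrite partialN// partialM//.
  by rewrite partial_cst mulr0 addr0.
have c2 i k : partial i (christoffel_lin k i k) x = 2^-1 * partial i (partial i (g k k)) x.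
  rewrite (_ : christoffel_lin k i k = (fun x => 2^-1 * partial i (g k k) x)); last first.
    by apply/funext => y; rewrite /christoffel_lin /D; field.
  rewrite partialM//.
  by rewrite partial_cst mulr0 addr0.
have := sum_scalar_lin (fun u i => partial u (partial i (g u i)) x)
  (fun i a => partial i (partial i (g a a)) x).
apply: etrans; apply: eq_bigr => i _; apply: eq_bigr => k _.
have c3 : partial k (partial i (g i k)) x = partial k (partial i (g k i)) x.
  apply: partial_far fx => y fy; apply: partial_far fy => z fz.
  by rewrite /g -[in LHS](G_sym fz) mxE.
by rewrite c1 c2 c3.
Qed.

(** The radial derivative of [f]. *)
Definition radial (f : 'rV[R]_n -> R) x : R :=
  \sum_j partial j f x * (x 0 j / enorm x).

Lemma symbol_energy_potential : symbol 2 (- t - 2) energy_potential.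
Proof.
by apply: symbolB; apply: symbol_sum => i _; apply: symbol_sum => j _; exact: symbol_ddmetric.
Qed.

Lemma energy_densityE x : far x -> energy_density G x = radial energy_potential x.
Proof.
move=> fx; rewrite /energy_density /radial; apply: eq_bigr => j _.
have d i j k l := symbol_diff (symbol_ddmetric i j k l) fx.
have dd (F : 'I_n -> 'I_n -> 'rV[R]_n -> R) :
    (forall i j, symbol 2 (- t - 2) (F i j)) ->
  differentiable (fun x => \sum_u \sum_i F u i x) x /\
  partial j (fun x => \sum_u \sum_i F u i x) x = \sum_u \sum_i partial j (F u i) x.
  move=> sF; have ds u : symbol 2 (- t - 2) (fun x => \sum_i F u i x).
    exact: symbol_sum.
  split; first by apply: symbol_diff fx; apply: symbol_sum => u _; exact: ds.
  rewrite partial_sum; last by move=> u; exact: symbol_diff (ds u) _ fx.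
  by apply: eq_bigr => u _; rewrite partial_sum// => i; exact: symbol_diff (sF u i) _ fx.
have [d1 e1] := dd _ (fun i a => symbol_ddmetric i i a a).
have [d2 e2] := dd _ (fun u i => symbol_ddmetric u i u i).
have -> // : partial j energy_potential x =
  \sum_i \sum_a partial j (partial i (partial i (g a a))) x -
  \sum_u \sum_i partial j (partial u (partial i (g u i))) x.
apply: etrans (partialD j d1 (differentiableN d2)) _.
apply: etrans (f_equal2 (fun a b : R => a + b) e1 (partialN j d2)) _.
exact: (f_equal (fun b : R => _ - b) e2).
Qed.

Lemma symbol_scalar : symbol 2 (- t - 2) (scalar_coord G).
Proof.
have : symbol 2 (- t - 2) (fun x => (scalar_coord G x - scalar_lin x) + scalar_lin x).
  apply: symbolD; first by apply: symbol_le symbol_scalar_quad; rewrite opprD addrA lerD2r gerDl.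
  by apply: symbol_sum => i _; exact: symbol_ricci_lin.
by apply: symbol_ext => x _; rewrite subrK.
Qed.

(** The energy density is minus the radial derivative of the scalar curvature, up
    to the radial derivative of a function quadratic in the deviation from the
    flat metric. *)
Lemma energy_density_scalar : exists H, [/\ symbol 2 (- t - (t + 2)) H &
  forall x, far x -> energy_density G x = radial H x - radial (scalar_coord G) x].
Proof.
exists (fun x => scalar_coord G x + energy_potential x); split.
  apply: symbol_ext symbol_scalar_quad => x fx; by rewrite scalar_linE// opprK.
move=> x fx; rewrite energy_densityE// -sumrB; apply: eq_bigr => j _.
rewrite (partialD _ (symbol_diff symbol_scalar fx) (symbol_diff symbol_energy_potential fx)).
by rewrite -mulrBl [X in X - _]addrC addrK.
Qed.

End curvature_asymptotics.

(** * Lebesgue measure under dilations *)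

Section scaling.
Variable R : realType.
Local Open Scope ereal_scope.
Notation mu := (@lebesgue_measure R).

Lemma measurable_open_continuous n (D : set 'rV[R]_n) (f : 'rV[R]_n -> R) :
  open D -> (forall x, D x -> {for x, continuous f}) ->
  measurable_fun (D : set (borel 'rV[R]_n)) f.
Proof.
move=> oD cf; apply: (measurability _ (RGenOInfty.measurableE R)).
move=> _ [_ [x ->] <-]; apply: sub_sigma_algebra.
rewrite openE => y [Dy fy]; apply: filterI; first exact: open_nbhs_nbhs.
by apply: (cf _ Dy); apply: open_nbhs_nbhs; split => //; exact: interval_open.
Qed.

Lemma measurable_scale n (a : R) :
  measurable_fun setT (fun x : borel 'rV[R]_n => a *: x : borel 'rV[R]_n)%R.
Proof.
apply: measurable_fun_rV => i; under eq_fun do rewrite mxE.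
by apply: measurable_funM => //; exact: measurable_coord.
Qed.

Lemma lebesgue_measure_scale (a : R) (h : R -> \bar R) : (0 < a)%R ->
  measurable_fun setT h -> (forall t, 0 <= h t) ->
  \int[mu]_t h (a * t)%R = a^-1%:E * \int[mu]_t h t.
Proof.
move=> a0 mh h0.
have ma : measurable_fun setT ( *%R a : R -> measurableTypeR R) by exact: mulrl_measurable.
have a0' : (0 <= a)%R by exact: ltW.
pose nu := mscale (NngNum a0') (pushforward mu ( *%R a : R -> measurableTypeR R)).
have nuE A : measurable A -> mu A = nu ma A.
  apply: lebesgue_measure_unique => _ [[x y]] _ <-.
  transitivity (a%:E * mu `](x / a)%R, (y / a)%R]%classic).
    rewrite !lebesgue_measure_itv/= !lte_fin ltr_pM2r ?invr_gt0//.
    case: ifPn => _; last by rewrite mule0.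
    by rewrite -!EFinB -EFinM -mulrBl mulrCA divff ?gt_eqF// mulr1.
  have -> : `](x / a)%R, (y / a)%R]%classic = ( *%R a) @^-1` `]x, y] .
    by apply/seteqP; split => t /=; rewrite !in_itv/= ltr_pdivrMr// ler_pdivlMr// (mulrC t).
  by [].
have -> : \int[mu]_t h t = \int[nu ma]_t h t .
  by apply: eq_measure_integral => A mA _; exact: nuE.
rewrite ge0_integral_mscale// muleA -EFinM mulVf ?gt_eqF// mul1e.
by rewrite ge0_integral_pushforward.
Qed.

Lemma integral_lebesgue_rVS n (f : borel 'rV[R]_n.+1 -> \bar R) :
  measurable_fun setT f -> (forall x, 0 <= f x) ->
  \int[lebesgue_rV R n.+1]_x f x =
  \int[mu]_t \int[lebesgue_rV R n]_v f (cons_rV (t, v)).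
Proof.
move=> mf f0.
transitivity (\int[(mu \x lebesgue_rV R n)]_z f (cons_rV z)).
  have mc : measurable_fun setT (@cons_rV R n : measurableTypeR R * borel 'rV[R]_n -> _).
    exact: measurable_cons_rV.
  have := @ge0_integral_pushforward _ _ _ _ R _ mc
    (mu \x lebesgue_rV R n) setT f measurableT mf (fun y _ => f0 y).
  rewrite preimage_setT. exact.
apply: fubini_tonelli1 => //.
apply: measurableT_comp => //; exact: measurable_cons_rV.
Qed.

Lemma cons_rVZ n (a t : R) (v : borel 'rV[R]_n) :
  (a *: (cons_rV (t, v) : 'rV_n.+1) = cons_rV ((a * t), (a *: v)) :> 'rV_n.+1)%R.
Proof.
apply/rowP => i; rewrite mxE /cons_rV/=.
case: (split_ordP (i : 'I_(1 + n))) => j ->.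
  by rewrite !(@row_mxEl R 1 1 n) !mxE.
by rewrite !(@row_mxEr R 1 1 n) mxE.
Qed.

(** By induction on the dimension: Tonelli's theorem splits off one coordinate. *)
Lemma lebesgue_rV_scale n (a : R) (f : borel 'rV[R]_n -> \bar R) : (0 < a)%R ->
  measurable_fun setT f -> (forall x, 0 <= f x) ->
  \int[lebesgue_rV R n]_x f (a *: x)%R =
  (a ^- n)%:E * \int[lebesgue_rV R n]_x f x.
Proof.
move=> a0; elim: n f => [|n ih] f mf f0.
  rewrite expr0 invr1 mul1e; apply: eq_integral => x _.
  by congr f; apply/rowP => -[].
have mfa : measurable_fun setT (fun x : borel 'rV[R]_n.+1 => f (a *: x)%R).
  by apply: (measurableT_comp mf); exact: measurable_scale.
rewrite !integral_lebesgue_rVS//.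
have mfc : measurable_fun setT (fun z : R * borel 'rV[R]_n => f (cons_rV z)).
  by apply: (measurableT_comp mf); exact: measurable_cons_rV.
pose F t := \int[lebesgue_rV R n]_v f (cons_rV (t, v)).
have mF : measurable_fun setT F.
  exact: (@measurable_fun_fubini_tonelli_F _ _ _ _ _ _ (fun z => f (cons_rV z))).
have F0 t : 0 <= F t by exact: integral_ge0.
transitivity (\int[mu]_t ((a ^- n)%:E * F (a * t)%R)).
  apply: eq_integral => t _; rewrite /F -ih//.
    by apply: eq_integral => v _; rewrite cons_rVZ.
  by apply: (measurableT_comp mfc); exact: measurable_pair1.
have an0 : 0 <= (a ^- n)%:E by rewrite lee_fin invr_ge0 exprn_ge0// ltW.
have mFa : measurable_fun (setT : set (measurableTypeR R)) (fun t => F (a * t)%R).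
  by apply: (measurableT_comp mF); exact: mulrl_measurable.
have E1 := @ge0_integralZl _ _ R mu setT measurableT _ mFa _ (fun t _ => F0 _) an0.
apply: (etrans E1).
have -> : \int[mu]_t F (a * t)%R = a^-1%:E * \int[mu]_t F t.
  exact: lebesgue_measure_scale.
by rewrite muleA -EFinM exprS invfM mulrC.
Qed.

Lemma integral_rV_scale n (a : R) (g : borel 'rV[R]_n -> \bar R) : (0 < a)%R ->
  (lebesgue_rV R n).-integrable setT g ->
  \int[lebesgue_rV R n]_x g (a *: x)%R =
  (a ^- n)%:E * \int[lebesgue_rV R n]_x g x.
Proof.
move=> a0 ig; have mg : measurable_fun setT g by exact: measurable_int ig.
rewrite [LHS]integralE [in RHS]integralE muleBr//; last first.
  by apply: fin_num_adde_defr; exact: integrable_pos_fin_num.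
rewrite -!lebesgue_rV_scale//.
- by rewrite -[fun x => g _]/(g \o _) funepos_comp funeneg_comp.
- exact: measurable_funeneg.
- exact: measurable_funepos.
Qed.

Lemma Rintegral_rV_scale n (a : R) (D : set (borel 'rV[R]_n))
    (f : borel 'rV[R]_n -> R) : (0 < a)%R -> measurable D ->
  (lebesgue_rV R n).-integrable D (EFin \o f) ->
  (\int[lebesgue_rV R n]_(x in D) f x =
   a ^+ n * \int[lebesgue_rV R n]_(x in [set x | D (a *: x)]) f (a *: x))%R.
Proof.
move=> a0 mD /integrable_mkcond => /(_ mD) ifD.
rewrite /Rintegral integral_mkcond [in RHS]integral_mkcond.
have -> : ((fun x => (f (a *: x)%R)%:E) \_ [set x | D (a *: x)%R]) =
    (fun x => ((EFin \o f) \_ D) (a *: x)%R).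
  apply/funext => x; rewrite /patch.
  by have -> : (x \in [set x | D (a *: x)%R]) = (a *: x \in D)%R by [].
rewrite integral_rV_scale// fineM//; last exact: integrable_fin_num.
by rewrite mulrA divff ?mul1r// expf_neq0// gt_eqF.
Qed.

(** The closed cube of half-side [e] around the origin.  Its volume shows both that
    balls have finite measure and, for [e = 0], that the origin is negligible in positive dimension. *)
Definition cube n (e : R) : set (borel 'rV[R]_n) := [set v | forall i, `|v 0%R i| <= e]%R.

Arguments cube : clear implicits.

Lemma measurable_cube n e : measurable (cube n e).
Proof.
have -> : cube n e = ~` \bigcup_(i : 'I_n)
    ~` ((fun v : borel 'rV[R]_n => v 0%R i : R) @^-1` `[(- e)%R, e]).
  rewrite setC_bigcup; apply/seteqP; split=> t /= ht i.
    have hi : `[(- e)%R, e]%classic (t 0%R i).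
      by rewrite /= in_itv/= -ler_norml; exact: ht.
    by move=> _ /(_ hi).
  have hi : `[(- e)%R, e]%classic (t 0%R i).
    by apply: contrapT; exact: (ht i Logic.I).
  by move: hi; rewrite /= in_itv/= -ler_norml.
apply: measurableC; apply: countable_bigcupT_measurable; first exact: countableP.
move=> i; apply: measurableC; rewrite -[X in measurable X]setTI.
by apply: measurable_coord => //; exact: measurable_itv.
Qed.

Lemma lebesgue_rV_cube n (e : R) : (0 <= e)%R ->
  lebesgue_rV R n (cube n e) = ((2 * e) ^+ n)%:E.
Proof.
move=> e0; elim: n => [|n ih].
  by rewrite expr0 /= diracE mem_set// => -[].
have mI : measurable (`[(- e)%R, e] : set R) by exact: measurable_itv.
transitivity ((mu \x lebesgue_rV R n) (`[(- e)%R, e]%classic `*` cube n e)).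
  rewrite /= /cons_measure /pushforward; congr (_ _).
  apply/seteqP; split => -[t v] /=; rewrite /cube/= /cons_rV/= in_itv/= -ler_norml.
    move=> H; split=> [|i].
      have := H (lshift n (0 : 'I_1)%R).
      by rewrite (@row_mxEl R 1 1 n) mxE.
    by have := H (rshift 1 i); rewrite (@row_mxEr R 1 1 n).
  move=> [te H] i; case: (split_ordP (i : 'I_(1 + n))) => j ->.
    by rewrite (@row_mxEl R 1 1 n) mxE.
  by rewrite (@row_mxEr R 1 1 n).
rewrite product_measure1E//; last exact: measurable_cube.
rewrite [X in _ * X]ih [X in X * _]lebesgue_measure_itv/= lte_fin.
have [|e0'] := ltP.
  by rewrite -EFinB -EFinM exprS opprK mulr_natl mulr2n.
have -> : e = 0%R by apply/eqP; rewrite eq_le e0 andbT; lra.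
by rewrite mul0e mulr0 exprS mul0r.
Qed.

(** The punctured open unit ball, on which [y |-> y / |y|] is continuous. *)
Definition pball n : set (borel 'rV[R]_n) := [set x | 0 < enorm x < 1]%R.

Arguments pball : clear implicits.

Lemma open_pball n : open (pball n : set 'rV[R]_n).
Proof.
have -> : pball n = [set x | 0 < enorm x]%R `&` [set x | enorm x < 1]%R.
  by apply/seteqP; split => x /=; rewrite /pball/= => /andP.
by apply: openI; [exact: open_enorm_gt|exact: open_enorm_lt].
Qed.

Lemma measurable_open n (D : set 'rV[R]_n) : open D -> measurable (D : set (borel 'rV[R]_n)).
Proof. by move=> oD; exact: sub_sigma_algebra. Qed.

Lemma measurable_pball n : measurable (pball n).
Proof. by apply: measurable_open; exact: open_pball. Qed.

Lemma lebesgue_rV_ball_fin n (r : R) :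
  lebesgue_rV R n [set x | enorm x < r]%R < +oo.
Proof.
apply: (@le_lt_trans _ _ (lebesgue_rV R n (cube n (Num.max r 0)%R))).
  apply: le_measure; rewrite ?inE.
  - by apply: measurable_open; exact: open_enorm_lt.
  - exact: measurable_cube.
  move=> x /= xr i; rewrite (le_trans (ler_coord_enorm _ _))//.
  by rewrite le_max (ltW xr).
by rewrite lebesgue_rV_cube ?ltry// le_max lexx orbT.
Qed.

Lemma lebesgue_rV_set0 n : (0 < n)%N -> lebesgue_rV R n [set 0%R] = 0.
Proof.
move=> n0; have -> : [set 0%R] = cube n 0.
  apply/seteqP; split => [x ->|x /= H] /=; first by move=> i; rewrite mxE normr0.
  by apply/rowP => i; rewrite mxE; apply/eqP; rewrite -normr_le0.
by rewrite lebesgue_rV_cube// mulr0 expr0n eqn0Ngt n0.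
Qed.

End scaling.
Arguments cube : clear implicits.
Arguments pball : clear implicits.

(** * Spherical means and their radial derivative *)

Section spheres.
Context {R : realType} {n : nat}.
Hypothesis n0 : (0 < n)%N.
Implicit Types (f : 'rV[R]_n -> R) (r : R).
Notation lam := (lebesgue_rV R n).

(* The point of the sphere of radius [r] in the direction of [y]. *)
Let dil r (y : 'rV[R]_n) : 'rV[R]_n := (r / enorm y) *: y.

Lemma enorm_dil r y : 0 <= r -> 0 < enorm y -> enorm (dil r y) = r.
Proof.
move=> r0 y0; rewrite enormZ normrM normfV (ger0_norm r0) (gtr0_norm y0).
by rewrite divfK ?gt_eqF.
Qed.

Lemma far_dil r y : 1 < r -> 0 < enorm y -> far (dil r y).
Proof. by move=> r1 y0; rewrite /far/= enorm_dil// ltW// (lt_trans ltr01). Qed.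

Lemma continuous_enormV (y : 'rV[R]_n) : 0 < enorm y ->
  {for y, continuous (fun y : 'rV[R]_n => (enorm y)^-1)}.
Proof.
move=> y0; apply: (@continuousV _ _ (@enorm R n)); first by rewrite gt_eqF.
exact: continuous_enorm.
Qed.

Lemma continuous_dil r y : 0 < enorm y -> {for y, continuous (dil r)}.
Proof.
move=> y0; apply: (@continuousZ _ _ _ (fun y : 'rV[R]_n => r / enorm y) id).
  apply: (@continuousM _ _ (fun=> r) (fun y : 'rV[R]_n => (enorm y)^-1)).
    exact: cst_continuous.
  exact: continuous_enormV.
exact: cvg_id.
Qed.

(* The punctured open ball of radius [r]; [D 1] is [pball R n]. *)
Let D r : set 'rV[R]_n := [set x | 0 < enorm x < r].

Let open_D r : open (D r).
Proof.
have -> : D r = [set x | 0 < enorm x]%R `&` [set x | enorm x < r]%R.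
  by apply/seteqP; split => x /=; rewrite /D/= => /andP.
by apply: openI; [exact: open_enorm_gt|exact: open_enorm_lt].
Qed.

Let measurable_dil s r f : 1 < r -> (forall x, far x -> {for x, continuous f}) ->
  measurable_fun (D s : set (borel 'rV[R]_n)) (fun y => f (dil r y)).
Proof.
move=> r1 cf; apply: measurable_open_continuous => // y /andP[y0 _].
apply: (@continuous_comp _ _ _ (dil r) f); first exact: continuous_dil.
exact/cf/far_dil.
Qed.

Let finite_D r : (lam (D r) < +oo)%E.
Proof.
apply: le_lt_trans (lebesgue_rV_ball_fin n r).
apply: le_measure; rewrite ?inE.
- by apply: measurable_open; exact: open_D.
- by apply: measurable_open; exact: open_enorm_lt.
by move=> x /= /andP[].
Qed.

Let integrable_dil s r f (C : R) : 1 < r -> (forall x, far x -> {for x, continuous f}) ->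
  (forall x, enorm x = r -> `|f x| <= C) ->
  lam.-integrable (D s) (EFin \o (fun y => f (dil r y))).
Proof.
move=> r1 cf fC; apply: measurable_bounded_integrable.
- by apply: measurable_open; exact: open_D.
- exact: finite_D.
- exact: measurable_dil.
exists C; split; first exact: num_real.
move=> M CM y /andP[y0 _]; apply: le_trans (ltW CM); apply: fC.
by rewrite enorm_dil// ltW// (lt_trans ltr01).
Qed.

(** The average of f over the sphere of radius r, up to a constant factor. *)
Definition sphere_mean f r : R :=
  \int[lam]_(y in (pball R n)) f ((r / enorm y) *: y).

(** The sphere integral, taken over the ball of radius [r], is rescaled to the
    unit ball.  The origin, where the integrand has no meaning, is negligible. *)
Lemma sphere_integralE f r (C : R) : 1 < r -> (forall x, far x -> {for x, continuous f}) ->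
  (forall x, enorm x = r -> `|f x| <= C) ->
  sphere_integral r f = n%:R * r ^+ n.-1 * sphere_mean f r.
Proof.
move=> r1 cf fC; have r0 : 0 < r by exact: lt_trans r1.
rewrite /sphere_integral.
have -> : \int[lam]_(x in [set x | enorm x < r]) f (dil r x) =
    \int[lam]_(x in D r) f (dil r x).
  have E0 : [set x | enorm x < r] = D r `|` [set 0].
    apply/seteqP; split => x /=; rewrite /D/=.
      move=> xr; have [->|x0] := eqVneq x 0; first by right.
      by left; rewrite enorm_gt0 x0.
    by move=> [/andP[]//|->]; rewrite enorm0.
  have mE : measurable ([set x | enorm x < r] : set (borel 'rV[R]_n)).
    by apply: measurable_open; exact: open_enorm_lt.
  have m0 : measurable ([set 0] : set (borel 'rV[R]_n)).
    have -> : [set 0] = [set x | enorm x < r] `\` D r.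
      apply/seteqP; split => x /=; rewrite /D/=; first by move=> ->; rewrite enorm0 ltxx.
      move=> [-> /negP]; rewrite andbT enorm_gt0 negbK => /eqP//.
    by apply: measurableD => //; apply: measurable_open; exact: open_D.
  pose B : set (borel 'rV[R]_n) := [set x | enorm x < r].
  pose N : set (borel 'rV[R]_n) := [set 0].
  have iB : lam.-integrable B (EFin \o (fun x => f (dil r x))).
    apply: measurable_bounded_integrable.
    - exact: mE.
    - exact: lebesgue_rV_ball_fin.
    - rewrite /B E0; apply/measurable_funU => //.
        by apply: measurable_open; exact: open_D.
      by split; [exact: measurable_dil|exact: measurable_fun_set1].
    exists (Num.max C `|f (dil r 0)|); split; first exact: num_real.
    move=> M; rewrite gt_max => /andP[CM fM] x _ /=.
    have [->|x0] := eqVneq x 0; first exact: ltW.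
    by apply: le_trans (ltW CM); apply: fC; rewrite enorm_dil ?enorm_gt0// ltW.
  have := @negligible_integral _ _ R lam B N _ m0 mE iB (lebesgue_rV_set0 R n0).
  have -> : B `\` N = D r.
    rewrite /B /N E0 setDUl setDv setU0.
    apply/seteqP; split => x /=; first by case.
    by move=> Dx; split => // x0; move: Dx; rewrite x0 /D/= enorm0 ltxx.
  by rewrite /Rintegral => ->.
rewrite (Rintegral_rV_scale r0); last 2 first.
- by apply: measurable_open; exact: open_D.
- exact: integrable_dil fC.
rewrite mulrA; congr (_ * _).
  by rewrite -mulrA -{2}(prednK n0) exprS mulKf// gt_eqF.
rewrite /sphere_mean.
have -> : [set x | D r (r *: x)] = pball R n.
  apply/seteqP; split => x; rewrite /D/pball/= enormZ gtr0_norm// pmulr_rgt0//;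
  by rewrite gtr_pMr.
apply: eq_Rintegral => x /[!inE] /andP[x0 _]; congr f.
rewrite /dil enormZ gtr0_norm// scalerA invfM mulrA divff ?gt_eqF// mul1r mulrC//.
Qed.

Let measurable_pb : measurable (pball R n). Proof. exact: measurable_pball. Qed.

Lemma sphere_meanE f : sphere_mean f = fun r => \int[lam]_(y in D 1) f (dil r y).
Proof. by []. Qed.

Lemma sphere_mean_le f r (C : R) : 1 < r -> (forall x, far x -> {for x, continuous f}) ->
  (forall x, enorm x = r -> `|f x| <= C) ->
  `|sphere_mean f r| <= C * fine (lam (pball R n)).
Proof.
move=> r1 cf fC; have r0 : 0 < r by exact: lt_trans r1.
rewrite sphere_meanE; have ifr := @integrable_dil 1 r f C r1 cf fC.
apply: le_trans (le_normr_Rintegral _ ifr) _ => //.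
rewrite -Rintegral_cst//; apply: le_Rintegral => //.
- exact: integrable_norm ifr.
- apply: measurable_bounded_integrable => //.
    exact: finite_D.
  by exists `|C|; split; [exact: num_real|move=> M CM y _; exact: ltW].
by move=> y /andP[y0 _]; apply: fC; rewrite enorm_dil// ltW.
Qed.

Lemma sphere_mean_ge0 f r : 1 < r -> (forall x, enorm x = r -> 0 <= f x) ->
  0 <= sphere_mean f r.
Proof.
move=> r1 f0; apply: Rintegral_ge0 => y /andP[y0 _]; apply: f0.
by rewrite enorm_dil// ltW// (lt_trans ltr01).
Qed.

Lemma sphere_meanB f h r (C C' : R) : 1 < r ->
  (forall x, far x -> {for x, continuous f}) ->
  (forall x, enorm x = r -> `|f x| <= C) ->
  (forall x, far x -> {for x, continuous h}) ->
  (forall x, enorm x = r -> `|h x| <= C') ->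
  sphere_mean (fun x => f x - h x) r = sphere_mean f r - sphere_mean h r.
Proof.
move=> r1 cf fC ch hC; rewrite /sphere_mean RintegralB//.
- exact: integrable_dil fC.
- exact: integrable_dil hC.
Qed.

Lemma sphere_mean_far f h r : 1 < r -> (forall x, far x -> f x = h x) ->
  sphere_mean f r = sphere_mean h r.
Proof.
by move=> r1 fh; apply: eq_Rintegral => y /[!inE] /andP[y0 _]; apply: fh; exact: far_dil.
Qed.

Lemma continuous_radial k a f : symbol k.+1 a f ->
  forall x, far x -> {for x, continuous (radial f)}.
Proof.
move=> sf x fx; rewrite /radial.
have H j : {for x, continuous (fun x => partial j f x * (x 0 j / enorm x))}.
  apply: (@continuousM _ _ (partial j f) (fun x : 'rV[R]_n => x 0 j / enorm x)).
    exact: differentiable_continuous (symbol_diff (symbol_partial j sf) fx).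
  apply: (@continuousM _ _ (fun x : 'rV[R]_n => x 0 j) (fun y : 'rV[R]_n => (enorm y)^-1)).
    exact: coord_continuous.
  by apply: continuous_enormV; rewrite (lt_trans ltr01).
apply: (@cvg_big _ _ _ _ xpredT (@add_continuous R) 'rV[R]_n (nbhs x) _ _ _ (nbhs_filter x)).
by move=> j _; exact: H.
Qed.

Lemma big_oh_radial k a f : symbol k.+1 a f -> big_oh (a - 1) (radial f).
Proof.
move=> sf; apply: big_oh_sum => j _; rewrite -[a - 1]addr0; apply: big_ohM.
  exact: symbol_big_oh (symbol_partial j sf).
exists 1, 1 => x x1; rewrite powRr0 mulr1 normrM normfV (ger0_norm (enorm_ge0 x)).
by rewrite ler_pdivrMr ?mul1r ?ler_coord_enorm// (lt_trans ltr01).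
Qed.

Lemma is_derive_dil k a f y r : symbol k a f -> 1 < r -> 0 < enorm y ->
  is_derive r 1 (fun r => f (dil r y)) (radial f (dil r y)).
Proof.
move=> sf r1 y0; have r0 : 0 < r by exact: lt_trans r1.
have df : differentiable f (dil r y) by exact: symbol_diff sf _ (far_dil r1 y0).
pose w := (enorm y)^-1 *: y.
have dilE s : dil s y = s *: w by rewrite /dil scalerA.
have -> : (fun r => f (dil r y)) = f \o ( *:%R ^~ w).
  by apply/funext => s /=; rewrite dilE.
have dw : is_diff r ( *:%R ^~ w) ( *:%R ^~ w) by exact: is_diff_scalel.
have df' : differentiable f (r *: w) by rewrite -dilE.
have dc : differentiable (f \o ( *:%R ^~ w)) r.
  by apply: differentiable_comp.
apply: DeriveDef; first exact/derivable1_diffP.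
rewrite deriveE// diff_comp//= diff_val scale1r -dilE.
rewrite /radial enorm_dil//; last exact: ltW.
have -> : w = \sum_j w 0 j *: delta_mx 0 j by exact: row_sum_delta.
rewrite linear_sum/=; apply: eq_bigr => j _.
rewrite linearZ/= -deriveE// -/(partial j f _) mulrC; congr (_ * _).
by rewrite !mxE; field; rewrite !gt_eqF.
Qed.

(** Differentiation under the integral sign; the radial derivative, a symbol of
    negative order, is dominated by a constant far away. *)
Lemma is_derive_sphere_mean k a f : a <= 0 -> symbol k.+1 a f ->
  exists rho, 1 <= rho /\ forall r, rho < r ->
    is_derive r 1 (sphere_mean f) (sphere_mean (radial f) r).
Proof.
move=> a0 sf.
have cf x : far x -> {for x, continuous f}.
  by move=> fx; exact: differentiable_continuous (symbol_diff sf fx).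
have [C [rho [C0 rho1 fC]]] := big_oh_pos (big_oh_le a0 (symbol_big_oh sf)).
have a10 : a - 1 <= 0 by lra.
have [C' [rho' [C'0 rho'1 rC]]] := big_oh_pos (big_oh_le a10 (big_oh_radial sf)).
pose M := Num.max rho rho'; exists M; split; first by rewrite le_max rho1.
move=> r Mr.
have M1 s : M < s -> 1 < s by apply: le_lt_trans; rewrite le_max rho1.
have dd s y : s \in `]M, r + 1[ -> pball R n y ->
    is_derive s 1 (fun r => f (dil r y)) (radial f (dil s y)).
  rewrite in_itv/= => /andP[Ms _] /andP[y0 _].
  exact: is_derive_dil sf (M1 _ Ms) y0.
have rI : r \in `]M, r + 1[ by rewrite in_itv/= Mr ltrDl ltr01.
have H1 x : `]M, r + 1[%classic x -> lam.-integrable (pball R n) (EFin \o (fun y => f (dil x y))).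
  rewrite /= in_itv/= => /andP[Mx _]; apply: (@integrable_dil 1 x f C).
  - exact: M1.
  - exact: cf.
  - move=> z zx; rewrite -[C]mulr1 -(powRr0 (enorm z)); apply: fC.
    by rewrite zx (le_lt_trans _ Mx)// le_max lexx.
have H2 x y : `]M, r + 1[%classic x -> pball R n y -> derivable (fun x => f (dil x y)) x 1.
  by move=> xI yB; have [] := dd x y xI yB.
have iC' : lam.-integrable (pball R n) (EFin \o cst C').
  apply: measurable_bounded_integrable => //.
    exact: finite_D.
  by exists `|C'|; split; [exact: num_real|move=> M' CM y _; exact: ltW].
have H3 x y : `]M, r + 1[%classic x -> pball R n y ->
    `|partial1of2 (fun x y => f (dil x y)) x y| <= cst C' y.
  move=> xI yB; have dxy := dd x y xI yB.
  rewrite partial1of2E derive_val/= -[C']mulr1 -(powRr0 (enorm (dil x y))).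
  move: xI yB => /=; rewrite in_itv/= => /andP[Mx _] /andP[y0 _].
  apply: rC; rewrite enorm_dil//; last by rewrite ltW// (lt_trans ltr01)// M1.
  by rewrite (le_lt_trans _ Mx)// le_max lexx orbT.
apply: DeriveDef.
  exact: (@derivable_under_integral _ _ _ lam (fun x y => f (dil x y)) _ measurable_pb
    r M (r + 1) rI H1 H2 (cst C') (fun=> ltW C'0) iC' H3).
rewrite -derive1E.
rewrite [LHS](@differentiation_under_integral _ _ _ lam (fun x y => f (dil x y)) _ measurable_pb
    r M (r + 1) rI H1 H2 (cst C') (fun=> ltW C'0) iC' H3).
apply: eq_Rintegral => y /[!inE] yB; have dxy := dd r y rI yB.
by rewrite partial1of2E derive_val.
Qed.

End spheres.

(** * The sign of the limit *)

(** [S] stands for the scalar curvature, [e] for the energy density and [H] for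
    the nonlinear part of the scalar curvature. *)
Section energy_sign.
Context {R : realType} {n : nat}.
Hypothesis n0 : (0 < n)%N.
Variables (S H e : 'rV[R]_n -> R) (t E : R).
Hypothesis t0 : 0 < t.
Hypothesis tn : n%:R < 2 * t + 4.
Hypothesis symbol_S : symbol 2 (- t - 2) S.
Hypothesis symbol_H : symbol 2 (- t - (t + 2)) H.
Hypothesis eE : forall x, far x -> e x = radial H x - radial S x.
Hypothesis S_gt0 : exists rho : R, forall x, rho < enorm x -> 0 < S x.
Hypothesis e_cvg : sphere_integral r e @[r --> +oo] --> E.

Lemma energy_ge0 : 0 <= E.
Proof.
have aux (a b c d : R) : d < 0 -> a - b < d / 2 -> - a <= c -> c <= - d / 4 -> 0 < b.
  by move=> *; lra.
move: (t0) (tn) => t_gt0 tn'.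
rewrite leNgt; apply/negP => E0.
have cH := continuous_radial symbol_H.
have cS := continuous_radial symbol_S.
have cS' x : far x -> {for x, continuous S}.
  by move=> fx; exact: differentiable_continuous (symbol_diff symbol_S fx).
have ce x : far x -> {for x, continuous e}.
  move=> fx; apply: (@cvg_trans _ (radial H y - radial S y @[y --> x])).
    have ne : \forall y \near x, radial H y - radial S y = e y.
      by apply: near_far => // y fy; rewrite eE.
    exact: near_eq_cvg ne.
  by rewrite eE//; exact: (continuousB (cH _ fx) (cS _ fx)).
have [CH [rH [CH0 rH1 bH]]] := big_oh_pos (big_oh_radial symbol_H).
have [CR [rR [CR0 rR1 bR]]] := big_oh_pos (big_oh_radial symbol_S).
have [CS [rS [CS0 rS1 bS]]] := big_oh_pos (symbol_big_oh symbol_S).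
have t2 : - t - 2 <= 0 by lra.
have [rD [rD1 dS]] := is_derive_sphere_mean t2 symbol_S.
have [rP S0] := S_gt0.
have E2 : E < E / 2 by lra.
have [rE [_ eE2]] : \forall r \near +oo, sphere_integral r e < E / 2.
  exact: cvgr_lt e_cvg _ E2.
pose V : R := fine (lebesgue_rV R n (pball R n)).
have V0 : 0 <= V by exact: fine_ge0.
have x0 : n%:R - 1 + (- t - (t + 2) - 1) < 0 :> R by lra.
have K0 : 0 < (- E / 4) / (n%:R * CH * V + 1).
  by rewrite divr_gt0 ?ltr_wpDl// ?mulr_ge0 ?(ltW CH0)//; lra.
have [rK [rK1 pK]] := powR_small x0 K0.
have [b bP] : exists b, forall r, b < r ->
    [/\ 1 < r, rH < r, rR < r, rS < r & [/\ rD < r, rP < r, rE < r & rK < r]].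
  exists (Num.max 1 (Num.max rH (Num.max rR (Num.max rS
    (Num.max rD (Num.max rP (Num.max rE rK))))))) => r.
  by rewrite !gt_max => /and3P[? ? /and3P[? ? /and4P[? ? ? ?]]].
have bH' r : b < r -> forall x, enorm x = r ->
    `|radial H x| <= CH * r `^ (- t - (t + 2) - 1).
  by move=> /bP[_ rHr _ _ _] x xr; rewrite -xr; apply: bH; rewrite xr.
have bR' r : b < r -> forall x, enorm x = r ->
    `|radial S x| <= CR * r `^ (- t - 2 - 1).
  by move=> /bP[_ _ rRr _ _] x xr; rewrite -xr; apply: bR; rewrite xr.
have bS' r : b < r -> forall x, enorm x = r -> `|S x| <= CS * r `^ (- t - 2).
  by move=> /bP[_ _ _ rSr _] x xr; rewrite -xr; apply: bS; rewrite xr.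
(* If the limit is negative, the spherical means of the radial derivative of [S]
   are eventually positive: the contribution of [H] is at most a quarter of [- E]. *)
have mean_pos r : b < r -> 0 < sphere_mean (radial S) r.
  move=> br; have [r1 _ _ _ [_ _ rEr rKr]] := bP _ br.
  have r0 : 0 < r by exact: lt_trans r1.
  have := eE2 _ rEr.
  have eB x : enorm x = r -> `|e x| <= CH * r `^ (- t - (t + 2) - 1) + CR * r `^ (- t - 2 - 1).
    move=> xr; rewrite eE; last by rewrite /far/= xr.
    by rewrite (le_trans (ler_normB _ _))// lerD ?bH' ?bR'.
  rewrite (sphere_integralE n0 r1 ce eB).
  have -> : sphere_mean e r = sphere_mean (radial H) r - sphere_mean (radial S) r.
    rewrite (sphere_mean_far r1 eE).
    exact: sphere_meanB r1 cH (bH' _ br) cS (bR' _ br).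
  have mH := sphere_mean_le r1 cH (bH' _ br).
  rewrite -/V in mH.
  have n1 : 0 < n%:R * r ^+ n.-1 by rewrite mulr_gt0 ?ltr0n// exprn_gt0.
  move=> le1; rewrite -(pmulr_rgt0 _ n1).
  have : n%:R * r ^+ n.-1 * `|sphere_mean (radial H) r| <= - E / 4.
    apply: le_trans (ler_wpM2l (ltW n1) mH) _.
    have -> : n%:R * r ^+ n.-1 * (CH * r `^ (- t - (t + 2) - 1) * V) =
        n%:R * CH * V * (r `^ (n%:R - 1 + (- t - (t + 2) - 1))).
      rewrite [r `^ (n%:R - 1 + _)]powRD; last by rewrite (gt_eqF r0) implybT.
      have -> : r `^ (n%:R - 1) = r ^+ n.-1.
        by rewrite -powR_mulrn ?ltW//; congr (_ `^ _); rewrite -subn1 natrB.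
      by ring.
    have := pK _ rKr; rewrite ltr_pdivlMr; last by rewrite ltr_wpDl// ?mulr_ge0// ltW.
    move=> /ltW; apply: le_trans; rewrite mulrC ler_wpM2l ?powR_ge0// lerDl//.
  have := ler_norm (- sphere_mean (radial H) r); rewrite normrN.
  move=> /(ler_wpM2l (ltW n1)).
  by move: le1; rewrite mulrBr mulrN; exact: aux E0.
(* By the mean value theorem the spherical means of [S] increase strictly. *)
have mono r s : b < r -> r < s -> sphere_mean S r < sphere_mean S s.
  move=> br rs.
  have H1 x : b < x -> is_derive x 1 (sphere_mean S) (sphere_mean (radial S) x).
    by move=> /bP[_ _ _ _ [rDx _ _ _]]; exact: dS.
  have H2 x : x \in `]r, s[ -> is_derive x 1 (sphere_mean S) (sphere_mean (radial S) x).
    by rewrite in_itv/= => /andP[rx _]; apply: H1; exact: lt_trans rx.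
  have H3 : {within `[r, s], continuous (sphere_mean S)}.
    apply: derivable_within_continuous => x; rewrite in_itv/= => /andP[rx _].
    by have [] := H1 x (lt_le_trans br rx).
  have [c crs] := MVT rs H2 H3.
  move=> /eqP; rewrite subr_eq => /eqP ->; rewrite ltrDr mulr_gt0 ?subr_gt0//.
  by apply: mean_pos; move: crs; rewrite in_itv/= => /andP[rc _]; exact: lt_trans rc.
have ge0 r : b < r -> 0 <= sphere_mean S r.
  move=> br; have [r1 _ _ _ [_ rPr _ _]] := bP _ br.
  by apply: sphere_mean_ge0 => // x xr; apply/ltW/S0; rewrite xr.
have b1 : b < b + 1 by rewrite ltrDl.
have b2 : b + 1 < b + 2 by rewrite ltrD2l ltr1n.
(* The means stay above [d > 0] beyond [b + 2], although they tend to 0. *)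
pose d := sphere_mean S (b + 2).
have d0 : 0 < d by apply: le_lt_trans (mono _ _ b1 b2); exact: ge0.
have y0 : - t - 2 < 0 by lra.
have L0 : 0 < d / (CS * V + 1) by rewrite divr_gt0// ltr_wpDl// mulr_ge0// ltW.
have [rL [rL1 pL]] := powR_small y0 L0.
pose r := Num.max (b + 2) rL + 1.
have br : b + 2 < r by rewrite /r -[ltLHS]addr0 ler_ltD// le_max lexx.
have br' : b < r by rewrite (lt_trans b1)// (lt_trans b2).
have Lr : rL < r by rewrite /r -[ltLHS]addr0 ler_ltD// le_max lexx orbT.
have [r1 _ _ _ _] := bP _ br'.
have := sphere_mean_le r1 cS' (bS' _ br'); rewrite -/V => /(le_trans (ler_norm _)).
apply/negP; rewrite -ltNge; apply: lt_trans (mono _ _ (lt_trans b1 b2) br).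
have := pL _ Lr; rewrite ltr_pdivlMr; last by rewrite ltr_wpDl// mulr_ge0// ltW.
apply: le_lt_trans; rewrite mulrAC mulrC ler_wpM2l ?powR_ge0// lerDl//.
Qed.

End energy_sign.

(** * Compact sets stay away from infinity *)

Section sup_norm.
Context {R : realType} {n : nat}.
Implicit Types (x : 'rV[R]_n) (A : 'M[R]_n).

Lemma ler_coord_norm x i : `|x 0 i| <= `|x|.
Proof. by rewrite [leRHS]/Num.Def.normr/= mx_normrE; exact: (le_bigmax _ _ (0, i)). Qed.

Lemma norm_rV_le x (L : R) : 0 <= L -> (forall i, `|x 0 i| <= L) -> `|x| <= L.
Proof.
move=> L0 H; rewrite [leLHS]/Num.Def.normr/= mx_normrE bigmax_le// => -[i j] _ /=.
by rewrite ord1; exact: H.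
Qed.

Lemma norm_le_enorm x : `|x| <= enorm x.
Proof. by apply: norm_rV_le (enorm_ge0 x) _ => i; exact: ler_coord_enorm. Qed.

Lemma enorm_le_norm x : enorm x <= n%:R * `|x|.
Proof.
rewrite -[leRHS]ger0_norm ?mulr_ge0// -sqrtr_sqr ler_sqrt ?sqr_ge0//.
apply: (@le_trans _ _ (\sum_(i < n) `|x| ^+ 2)).
  by apply: ler_sum => i _; rewrite -real_normK ?num_real// ler_sqr ?nnegrE// ler_coord_norm.
rewrite sumr_const card_ord -[leLHS]mulr_natl exprMn ler_wpM2r ?sqr_ge0//.
by rewrite -natrX ler_nat; case: (n) => // m; rewrite -mulnn leq_pmulr.
Qed.

Lemma norm_sqr_le_sum x : `|x| ^+ 2 <= \sum_i x 0 i ^+ 2.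
Proof.
have -> : \sum_i x 0 i ^+ 2 = enorm x ^+ 2.
  by rewrite sqr_sqrtr// sumr_ge0// => i _; exact: sqr_ge0.
by rewrite ler_sqr ?nnegrE ?enorm_ge0//; exact: norm_le_enorm.
Qed.



Lemma quad_formE A x : (x *m A *m x^T) 0 0 = \sum_i \sum_j x 0 i * A i j * x 0 j.
Proof.
rewrite mxE exchange_big/=; apply: eq_bigr => j _.
by rewrite !mxE mulr_suml.
Qed.

Lemma quad_form_le A x (B : 'I_n -> 'I_n -> R) (d : R) :
  (forall i j, `|A i j| <= B i j) -> `|x| <= d ->
  `|(x *m A *m x^T) 0 0| <= \sum_i \sum_j d * B i j * d.
Proof.
move=> AB xd; rewrite quad_formE.
have xid i : `|x 0 i| <= d by exact: le_trans (ler_coord_norm _ _) xd.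
apply: le_trans (ler_norm_sum _ _ _) _; apply: ler_sum => i _.
apply: le_trans (ler_norm_sum _ _ _) _; apply: ler_sum => j _.
by rewrite !normrM ler_pM// ?mulr_ge0// ler_pM.
Qed.

(** A matrix close to the identity is bounded below, for the sup norm. *)
Lemma quad_form_ge A x (e : R) : (forall i j, `|A i j - (i == j)%:R| <= e) ->
  (1 - n%:R * n%:R * e) * `|x| ^+ 2 <= (x *m A *m x^T) 0 0.
Proof.
move=> Ae; have -> : A = 1%:M + (A - 1%:M) by rewrite addrC subrK.
rewrite mulmxDr mulmx1 mulmxDl mxE mulrBl mul1r lerD//.
  rewrite mxE; apply: le_trans (norm_sqr_le_sum x) _.
  by apply: ler_sum => i _; rewrite mxE expr2.
have : `|(x *m (A - 1%:M) *m x^T) 0 0| <= \sum_(i < n) \sum_(j < n) `|x| * e * `|x|.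
  by apply: quad_form_le => // i j; rewrite !mxE.
rewrite !sumr_const !card_ord ler_norml => /andP[+ _]; apply: le_trans.
rewrite lerN2 -mulrnA -[X in X <= _]mulr_natl natrM.
by rewrite (_ : n%:R * n%:R * e * `|x| ^+ 2 = n%:R * n%:R * (`|x| * e * `|x|))//; ring.
Qed.

End sup_norm.

Section end_at_infinity.
Context {R : realType} {n : nat} {M : smooth_manifold R n}.
Variables (g : riemannian_metric M) (c : chart R n M) (rho : R).
Hypothesis ac : atlas c.
Hypothesis c_img : chart_img c = far.
Hypothesis rho1 : 1 <= rho.
Hypothesis g_ge : forall x : 'rV[R]_n, rho < enorm x ->
  forall xi : 'rV[R]_n, 2^-1 * `|xi| ^+ 2 <= (xi *m g c x *m xi^T) 0 0.

(** The segment from [y], the image of a point of the chart [c], to the image [y0]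
    of a point [p] outside this chart, in a chart [c'] around [p].  In [c'] the
    squared length of the direction of the segment is at most [B], so that the
    coordinates of [c] move along it with speed at most [L] as long as their
    norm exceeds [rho]. *)
Section segment.
Variables (c' : chart R n M) (p : M) (d B : R) (y : 'rV[R]_n).
Hypothesis ac' : atlas c'.
Let y0 := chart_map c' p.
Let w := y0 - y.
Hypothesis p_dom : chart_dom c' p.
Hypothesis p_far : ~ chart_dom c p.
Hypothesis B0 : 0 <= B.
Hypothesis yd : `|y0 - y| < d.
Hypothesis d_img : forall z, `|y0 - z| < d -> chart_img c' z.
Hypothesis d_quad : forall z, `|y0 - z| < d -> `|(w *m g c' z *m w^T) 0 0| <= B.

Let L := 2 * B + 1.
Let seg (s : R) : 'rV[R]_n := y + s *: w.
Let gam s := chart_inv c' (seg s).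
Let z s := transition c' c (seg s).

Let L0 : 0 <= L. Proof. by rewrite addr_ge0// mulr_ge0. Qed.

Let seg_d s : 0 <= s <= 1 -> `|y0 - seg s| < d.
Proof.
move=> /andP[s0 s1]; have -> : y0 - seg s = (1 - s) *: w.
  by rewrite /seg scalerBl scale1r /w opprD addrA.
rewrite normrZ ger0_norm ?subr_ge0//; apply: le_lt_trans yd.
by rewrite -[leRHS]mul1r ler_wpM2r// gerDl oppr_le0.
Qed.

Let seg_img s : 0 <= s <= 1 -> chart_img c' (seg s).
Proof. by move=> /seg_d; exact: d_img. Qed.

Let seg_diff (s : R) : is_diff s seg ( *:%R ^~ w).
Proof.
have : is_diff s (cst y + ( *:%R ^~ w)) (0 + ( *:%R ^~ w)).
  exact: is_diffD.
by rewrite add0r.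
Qed.

Let gam_cont s : 0 <= s <= 1 -> {for s, continuous gam}.
Proof.
move=> s01; apply: (@continuous_comp _ _ _ seg (chart_inv c')); last first.
  exact/chart_inv_continuous/seg_img.
by apply: differentiable_continuous; have [] := seg_diff s.
Qed.

Let z_deriv s i : 0 <= s <= 1 -> chart_dom c (gam s) ->
  is_derive s 1 (fun s => z s 0 i) ((w *m jacobian (transition c' c) (seg s)) 0 i).
Proof.
move=> s01 ds.
have ov : overlap c' c (seg s) by split; [exact: seg_img|].
have dj j : differentiable (fun x => transition c' c x 0 j) (seg s).
  by have [H _] := atlas_compatible ac' ac; exact: (H j [::] _ ov).
have dT : differentiable (transition c' c) (seg s).
  have -> : transition c' c = \sum_j (fun x => transition c' c x 0 j *: delta_mx 0 j).
    apply/funext => x; rewrite fct_sumE; exact: row_sum_delta.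
  apply: differentiable_sum => j.
  by apply: differentiableZl; exact: dj.
have dseg := seg_diff s.
have dz : differentiable z s by apply: differentiable_comp => //; exact: ex_diff.
have Dz : 'D_1 z s = w *m jacobian (transition c' c) (seg s).
  rewrite deriveE// diff_comp//= ?diff_val ?scale1r.
  by rewrite -deriveE// deriveEjacobian.
have der_z : derivable z s 1 by exact: diff_derivable.
apply: DeriveDef; first by apply: (derivable_mxP _ _ _).1.
by rewrite -Dz derive_mx// mxE.
Qed.

Let z_deriv_le s : 0 <= s <= 1 -> chart_dom c (gam s) -> rho < `|z s| ->
  `|w *m jacobian (transition c' c) (seg s)| <= L.
Proof.
move=> s01 ds zs.
have ov : overlap c' c (seg s) by split; [exact: seg_img|].
have := d_quad (seg_d s01); rewrite (metric_tensorial g ac' ac ov)/= -/(z s).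
set J := jacobian _ _.
have -> : w *m (J *m g c (z s) *m J^T) *m w^T =
    (w *m J) *m g c (z s) *m (w *m J)^T by rewrite trmx_mul !mulmxA.
have rz : rho < enorm (z s) by exact: lt_le_trans (norm_le_enorm _).
move=> qB; have qg := le_trans (le_trans (g_ge rz (w *m J)) (ler_norm _)) qB.
rewrite -ler_sqr ?nnegrE//.
apply: (@le_trans _ _ (2 * B)).
  by rewrite -ler_pdivrMl// ; exact: qg.
rewrite /L -subr_ge0 (_ : _ - _ = 4 * (B * B) + 2 * B + 1); last by ring.
by rewrite !addr_ge0// !mulr_ge0.
Qed.

Let z_dist s : 0 <= s <= 1 ->
  (forall u, 0 <= u <= s -> chart_dom c (gam u) /\ rho < `|z u|) ->
  `|z s - z 0| <= L.
Proof.
move=> /andP[s0 s1] H; apply: norm_rV_le => // i; rewrite mxE [X in _ + X]mxE.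
have u01 u : u \in `[0, s] -> 0 <= u <= 1.
  by rewrite in_itv/= => /andP[-> us]; exact: le_trans us s1.
have dz u : u \in `[0, s] -> is_derive u 1 (fun s => z s 0 i)
    ((w *m jacobian (transition c' c) (seg u)) 0 i).
  by move=> us; apply: z_deriv; [exact: u01|have [] := H u us].
have cz : {within `[0, s], continuous (fun s => z s 0 i)}.
  apply: derivable_within_continuous => u us.
  by have [] := dz u us.
have dz' u : u \in `]0, s[ -> is_derive u 1 (fun s => z s 0 i)
    ((w *m jacobian (transition c' c) (seg u)) 0 i).
  by move=> us; apply: dz; exact: subset_itv_oo_cc us.
have [u us ->] := MVT_segment s0 dz' cz.
rewrite subr0 normrM (ger0_norm s0) -[L]mulr1 ler_pM//.
apply: le_trans (ler_coord_norm _ _) _; have [du ru] := H u us.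
by apply: z_deriv_le => //; exact: u01.
Qed.

Lemma segment_bounded : chart_dom c (chart_inv c' y) ->
  `|chart_map c (chart_inv c' y)| <= rho + L + 1.
Proof.
have gam0 : gam 0 = chart_inv c' y by rewrite /gam /seg scale0r addr0.
have gam1 : gam 1 = p by rewrite /gam /seg scale1r /w addrC subrK /y0 chart_mapK.
move: L0 (rho1) => L_ge0 rho_ge1.
rewrite -gam0 => d0; rewrite leNgt; apply/negP => Nr.
set N := `|_| in Nr.
(* [N] is the sup norm of the coordinates at the start.  The curve cannot leave
   the open annulus [O], since its coordinates stay in the smaller compact
   annulus [F] up to the first time [T] at which it would. *)
pose O : set M := [set q | chart_dom c q /\ N - L - 1 < `|chart_map c q| < N + L + 1].
have O_open : open O.
  rewrite openE => q [dq /andP[q1 q2]]; apply: filterI.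
    by apply: open_nbhs_nbhs; split => //; exact: chart_dom_open.
  have cn : `|chart_map c x| @[x --> q] --> `|chart_map c q|.
    by apply: cvg_norm; exact: chart_map_continuous.
  by near=> x; apply/andP; split; near: x; [exact: cvgr_gt cn _ q1|exact: cvgr_lt cn _ q2].
pose F : set 'rV[R]_n := [set x | N - L <= `|x| <= N + L].
have F_far x : F x -> far x.
  move=> /andP[x1 _]; apply: lt_le_trans (norm_le_enorm _).
  by apply: lt_le_trans x1; rewrite ltrBrDr (le_lt_trans _ Nr)//; lra.
have F_compact : compact F.
  apply: bounded_closed_compact.
    exists (N + L); split; first exact: num_real.
    by move=> a Na x /andP[_ xN]; exact: le_trans (ltW Na).
  have -> : F = (fun x : 'rV[R]_n => `|x|) @^-1` `[N - L, N + L]%classic.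
    by apply/seteqP; split => x /=; rewrite in_itv.
  apply: closed_comp; last exact: interval_closed.
  by move=> x _; exact: norm_continuous.
have FK : closed (chart_inv c @` F).
  apply: compact_closed; first exact: manifold_hausdorff.
  apply: continuous_compact => //.
  apply: continuous_in_subspaceT => x /[!inE] /F_far fx.
  by apply: chart_inv_continuous; rewrite c_img.
have rN : rho < N - L - 1 by lra.
pose Z : set R := [set s | 0 <= s <= 1 /\ ~ O (gam s)].
have Z1 : Z 1 by split; [rewrite ler01 lexx|rewrite gam1 => -[]].
have Zlb : has_lbound Z by exists 0 => s [/andP[]].
have Zinf : has_inf Z by split => //; exists 1.
pose T := inf Z.
have T0 : 0 <= T by apply: lb_le_inf; [exists 1|move=> s [/andP[]]].
have T1 : T <= 1 by exact: ge_inf.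
have T01 : 0 <= T <= 1 by rewrite T0.
have ltT s : 0 <= s -> s < T -> O (gam s).
  move=> s0 sT; apply: contrapT => nO; move: (sT); apply/negP; rewrite -leNgt.
  by apply: ge_inf => //; split => //; rewrite s0 (le_trans (ltW sT)).
have distT s : 0 <= s -> s < T -> `|z s - z 0| <= L.
  move=> s0 sT; apply: z_dist => [|u /andP[u0 us]].
    by rewrite s0 (le_trans (ltW sT)).
  have [du /andP[ru _]] := ltT u u0 (le_lt_trans us sT).
  by split => //; exact: lt_trans ru.
have OT : O (gam T).
  move: T0; rewrite le_eqVlt => /predU1P[T0'|T0'].
    by rewrite -T0'; split => //; rewrite -/N; apply/andP; split; lra.
  have : (chart_inv c @` F) (gam T).
    apply: contrapT => nK.
    have : \forall s \near T, ~ (chart_inv c @` F) (gam s).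
      have nF : nbhs (gam T) (~` (chart_inv c @` F)).
        by apply: open_nbhs_nbhs; split => //; exact: closed_openC.
      exact: (gam_cont T01 nF).
    move=> /nbhs_ballP[e /= e0 eT].
    pose s := Num.max 0 (T - e / 2).
    have s0 : 0 <= s by rewrite le_max lexx.
    have sT : s < T by rewrite gt_max T0' ltrBlDr ltrDl divr_gt0.
    apply: (eT s).
      rewrite /ball/= ger0_norm ?subr_ge0 ?(ltW sT)// ltrBlDr -ltrBlDl.
      by rewrite lt_max ltrD2l ltrN2; apply/orP; right; lra.
    exists (z s); last by rewrite /z /transition/= chart_mapK//; have [] := ltT s s0 sT.
    have := distT s s0 sT; have := ler_dist_dist (z s) (z 0).
    move=> /le_trans /[apply]; rewrite ler_norml -/N => /andP[h1 h2].
    by rewrite /F/=; apply/andP; split; lra.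
  move=> [x Fx <-]; have fx : chart_img c x by rewrite c_img; exact: F_far.
  split; first exact: chart_inv_dom.
  by rewrite chart_invK//; move: Fx => /andP[x1 x2]; apply/andP; split; lra.
have : \forall s \near T, O (gam s).
  have nT : nbhs (gam T) O by exact: open_nbhs_nbhs.
  exact: (gam_cont T01 nT).
move=> /nbhs_ballP[e /= e0 eT].
have [s Zs sT] := inf_adherent e0 Zinf; have [_ nO] := Zs.
apply: nO; apply: eT; rewrite /ball/= distrC ger0_norm ?subr_ge0.
  by rewrite ltrBlDl.
exact: ge_inf.
Unshelve. all: by end_near. Qed.

End segment.

(** Near any point of the manifold, the coordinates of the chart at infinity are
    bounded. *)
Lemma chart_bounded_near (p : M) : exists C : R,
  \forall q \near p, chart_dom c q -> `|chart_map c q| <= C.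
Proof.
have [dp|ndp] := pselect (chart_dom c p).
  exists (`|chart_map c p| + 1).
  have cn : `|chart_map c x| @[x --> p] --> `|chart_map c p|.
    by apply: cvg_norm; exact: chart_map_continuous.
  have p1 : `|chart_map c p| < `|chart_map c p| + 1 by rewrite ltrDl.
  by apply: filterS (cvgr_lt _ cn _ p1) => q /ltW qp _; exact: qp.
have [c' ac' dp] := atlas_cover p.
pose y0 := chart_map c' p.
have i0 : chart_img c' y0 by exact: chart_map_img.
have gc i j : {for y0, continuous (fun x => g c' x i j)}.
  have dg : differentiable (fun x => g c' x i j) y0.
    exact: (metric_smooth g ac' i j [::] i0).
  exact: differentiable_continuous dg.
pose K i j := `|g c' y0 i j| + 1.
have gK i j : \forall y \near y0, `|g c' y i j| <= K i j.
  have cn : `|g c' x i j| @[x --> y0] --> `|g c' y0 i j|.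
    exact: (cvg_norm (gc i j)).
  have p1 : `|g c' y0 i j| < K i j by rewrite ltrDl.
  by apply: filterS (cvgr_lt _ cn _ p1) => q /ltW.
have gKi i : \forall y \near y0, forall j, `|g c' y i j| <= K i j.
  exact: (filter_forall _ (gK i)).
have : \forall y \near y0, chart_img c' y /\ forall i j, `|g c' y i j| <= K i j.
  apply: filterI.
    by apply: open_nbhs_nbhs; split => //; exact: chart_img_open.
  exact: (filter_forall _ gKi).
move=> /nbhs_ballP[d /= d0]; rewrite -ball_normE => dP.
pose B := \sum_i \sum_j d * K i j * d.
exists (rho + (2 * B + 1) + 1).
have cp : chart_map c' @ p --> y0 by exact: chart_map_continuous.
have np : \forall q \near p, chart_dom c' q /\ ball y0 d (chart_map c' q).
  apply: filterI.
    by apply: open_nbhs_nbhs; split => //; exact: chart_dom_open.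
  by apply: cp; exact: nbhsx_ballx.
apply: filterS np => q [dq]; rewrite -ball_normE/= => yd dcq.
have B0 : 0 <= B.
  by do 2 (apply: sumr_ge0 => ? _); rewrite !mulr_ge0 ?(ltW d0)// addr_ge0.
rewrite -(chart_mapK dq); apply: (segment_bounded ac' dp ndp B0 yd).
- by move=> z /dP[].
- by move=> z /dP[_ zK]; apply: quad_form_le => //; exact: ltW.
- by rewrite chart_mapK.
Qed.

(** A compact subset of the manifold does not reach the end of the chart. *)
Lemma compact_avoided (K : set M) : compact K ->
  exists r : R, forall x, r < enorm x -> far x -> ~ K (chart_inv c x).
Proof.
move=> /compact_near_coveringP K_cov.
have : \forall r \near +oo, K `<=` (fun q => chart_dom c q -> `|chart_map c q| <= r).
  apply: (K_cov R _ (fun r q => chart_dom c q -> `|chart_map c q| <= r)) => p _.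
  have [C HC] := chart_bounded_near p.
  exists ([set q | chart_dom c q -> `|chart_map c q| <= C], [set r | C <= r]).
    split; first exact: HC.
    by exists C; split; [exact: num_real|move=> r /ltW].
  by move=> [q r] /= [qC Cr] /qC /le_trans; exact.
move=> [r0 [_ rP]]; pose r := r0 + 1.
exists (n%:R * r) => x rx fx Kx.
have ix : chart_img c x by rewrite c_img.
have := rP r _ _ Kx; rewrite chart_invK// ltrDl => /(_ ltr01 (chart_inv_dom ix)).
move=> /(ler_wpM2l (ler0n R n)) /(le_trans (enorm_le_norm x)).
by apply/negP; rewrite -ltNge.
Qed.

End end_at_infinity.

(** * The metric in a chart at infinity and the theorem *)

Section metric_in_chart.
Context {R : realType} {n : nat} {M : smooth_manifold R n}.
Variables (g : riemannian_metric M) (c : chart R n M) (t : R).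
Hypothesis ac : atlas c.
Hypothesis c_img : chart_img c = far.
Hypothesis t0 : 0 < t.
Hypothesis g_flat : flat_at_infinity g t c.

Lemma partialBcst i (f : 'rV[R]_n -> R) (a : R) :
  partial i (fun x => f x - a) = partial i f.
Proof.
apply/funext => x; rewrite /partial /derive.
set q := (X in lim (X @ _)); set q' := (X in _ = lim (X @ _)).
suff -> : q = q' by [].
by apply/funext => h; rewrite /q /q' /= opprB addrA subrK.
Qed.

Lemma asymptotic_metric i j : asymptotic 4 (- t) (i == j)%:R (fun x => g c x i j).
Proof.
apply: symbol_of_O_infty (g_flat i j) => s _ x fx.
have ix : chart_img c x by rewrite c_img.
have d u : differentiable (iter_partial u (fun x => g c x i j)) x.
  exact: (metric_smooth g ac i j u ix).
elim/last_ind: s => [|s k _].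
  by apply: differentiableB => //; exact: (d [::]).
by rewrite /iter_partial foldr_rcons partialBcst -foldr_rcons; exact: d.
Qed.

Lemma det_metric_neq0 x : far x -> \det (g c x) != 0.
Proof.
move=> fx; have ix : chart_img c x by rewrite c_img.
apply/negP => /det0P[v v0 vg].
by have := metric_posdef g ac ix v0; rewrite vg mul0mx mxE ltxx.
Qed.

(** Far away, the metric dominates half of the sup norm squared. *)
Lemma metric_elliptic : exists rho : R, 1 <= rho /\
  forall x, rho < enorm x -> forall xi : 'rV[R]_n,
    2^-1 * `|xi| ^+ 2 <= (xi *m g c x *m xi^T) 0 0.
Proof.
pose F x := \sum_i \sum_j `|g c x i j - (i == j)%:R|.
have OF : big_oh (- t) F.
  apply: big_oh_sum => i _; apply: big_oh_sum => j _.
  have [C [r H]] := symbol_big_oh (asymptotic_metric i j).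
  by exists C, r => x /H; rewrite normr_id.
have Nt : - t < 0 by rewrite oppr_lt0.
pose e : R := (2 * (n%:R * n%:R + 1))^-1.
have nn : 0 <= n%:R * n%:R :> R by rewrite mulr_ge0.
have e0 : 0 < e by rewrite invr_gt0 mulr_gt0// ltr_wpDl.
have [rho [rho1 Fe]] := big_oh_small Nt e0 OF.
exists rho; split => // x /Fe Fx xi.
apply: le_trans (quad_form_ge (e := e) xi _).
  rewrite ler_wpM2r ?sqr_ge0// lerBrDl -lerBrDr.
  rewrite /e ler_pdivrMr ?mulr_gt0// ?ltr_wpDl//.
  by lra.
move=> i j; apply: le_trans (ltW Fx); apply: le_trans (ler_norm _).
rewrite /F (bigD1 i)//= (bigD1 j)//= -addrA lerDl addr_ge0// ?sumr_ge0// => u _.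
by rewrite sumr_ge0.
Qed.

(** The scalar curvature is the default value 0 when the coordinate expressions
    in the various charts disagree; so, if it is positive, it is the one of [c]. *)
Lemma scalar_curvature_gt0 x : far x -> 0 < scalar_curvature g (chart_inv c x) ->
  0 < scalar_coord (g c) x.
Proof.
move=> fx; have ix : chart_img c x by rewrite c_img.
rewrite /scalar_curvature /chartwise; set P := (X in xget _ X).
have [[s Ps]|nP] := pselect (exists s, P s).
  have := xgetPex 0 (ex_intro _ s Ps) c ac (chart_inv_dom ix).
  by rewrite chart_invK// => ->.
by rewrite xgetPN ?ltxx// => s Ps; apply: nP; exists s.
Qed.

End metric_in_chart.


Theorem theorem3 (R : realType) (n : nat) (hn : (3 <= n)%N)
    (M : smooth_manifold R n) (g : riemannian_metric M)
    (hAE : asymptotically_euclidean g)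
    (hi : exists c, admissible_structure g c)
    (dV : {measure set (borel M) -> \bar R}) (hdV : riemannian_volume g dV)
    (hii : dV.-integrable setT (fun p => (Q_curvature g p)%:E))
    (K : set M) (hK : compact K)
    (hpos : forall p, ~ K p -> 0 < scalar_curvature g p)
    (E : R) (hE : is_fourth_order_energy g E) :
  0 <= E.
Proof.
have [c [[ac _ c_img] [t ht g_flat]] e_cvg] := hE.
have tn : 0 < t /\ n%:R < 2 * t + 4.
  move: ht; rewrite /critical_order; case: ifPn => [n4 t0|n4 ht].
    have n4' : n%:R <= 4 :> R by rewrite ler_nat.
    by split => //; lra.
  have n5 : 5 <= n%:R :> R by rewrite ler_nat ltnNge.
  by split; lra.
have {tn}[t0 tn] := tn.
have n0 : (0 < n)%N by exact: leq_trans hn.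
have [rho [rho1 g_ge]] := metric_elliptic ac c_img t0 g_flat.
have [r Kr] := compact_avoided ac c_img rho1 g_ge hK.
have g_asym := asymptotic_metric ac c_img g_flat.
have g_det := det_metric_neq0 g ac c_img.
have g_sym x : far x -> (g c x)^T = g c x.
  by move=> fx; apply: metric_symmetric => //; rewrite c_img.
have [H [sH eH]] := energy_density_scalar t0 g_asym g_det g_sym.
apply: (energy_ge0 n0 t0 tn (symbol_scalar t0 g_asym g_det) sH eH _ e_cvg).
exists (Num.max 1 r) => x; rewrite gt_max => /andP[x1 xr].
by apply: (scalar_curvature_gt0 ac c_img x1); apply: hpos; exact: Kr.
Qed.
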